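(* Let $G=(V,E)$ be an infinite, connected, simple, quasi-transitive graph with bounded maximum degree, let the initial water levels $\{\eta_0(u)\}_{u\in V}$ be i.i.d. random variables uniformly distributed on $[0,1]$, and let $v\in V$ be a fixed vertex. Let $\kappa_G(v)$ denote the supremum of water levels achievable at $v$ by finite move sequences, starting from the initial profile $\{\eta_0(u)\}_{u\in V}$. (1) If $G$ is the two-sided infinite path $\mathbb{Z}$, i.e. $V=\mathbb{Z}$ and $E=\{\langle u,u+1\rangle : u\in\mathbb{Z}\}$, then $$\mathbb{P}\big(\tfrac12<\kappa_{\mathbb{Z}}(v)<1\big)=1\quad\text{and}\quad \{\tfrac12,1\}\subseteq \mathrm{supp}\big(\kappa_{\mathbb{Z}}(v)\big).$$ (2) If $G$ is not (isomorphic to) the two-sided infinite path, then $\kappa_G(v)=1$ almost surely.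
   Context: All graphs are undirected; simple means having neither loops nor multiple edges; $\langle x,y\rangle$ denotes the edge between $x$ and $y$; $\mathbb{N}_0=\{0,1,2,\dots\}$. Water transport. Given an initial water profile $\{\eta_0(u)\}_{u\in V}\in[0,1]^V$, a move is a pair $(e,\mu)\in E\times(0,\tfrac12]$. A finite sequence of moves $(e_1,\mu_1),\dots,(e_T,\mu_T)$, $T\in\mathbb{N}_0$, produces profiles $\eta_1,\dots,\eta_T$ recursively: if $e_k=\langle x,y\rangle$, $\eta_{k-1}(x)=a$ and $\eta_{k-1}(y)=b$, then $$\eta_k(x)=a+\mu_k(b-a),\qquad \eta_k(y)=b+\mu_k(a-b),$$ and $\eta_k(w)=\eta_{k-1}(w)$ for all $w\in V\setminus\{x,y\}$. For $v\in V$, $$\kappa_G(v):=\sup\{r\ge 0:\ \text{there exist } T\in\mathbb{N}_0 \text{ and a move sequence of length } T \text{ such that } \eta_T(v)=r\}.$$ The move sequence may be chosen depending on the initial profile. When the initial profile is random, $\kappa_G(v)$ is a random variable. Quasi-transitivity. A graph automorphism of $G$ is a bijection $f:V\to V$ such that $\langle f(u),f(w)\rangle\in E$ if and only if $\langle u,w\rangle\in E$. $G$ is quasi-transitive if $V$ can be partitioned into finitely many classes such that for any two vertices $u,w$ in the same class there is a graph automorphism $f$ with $f(u)=w$. Support. For a real random variable $X$, $\mathrm{supp}(X):=\{r\in\mathbb{R}:\ \forall\,\epsilon>0,\ \mathbb{P}(|X-r|<\epsilon)>0\}$. *)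

(* Defs.v *)
From HB Require Import structures.
From mathcomp Require Import all_boot all_order all_algebra.
From mathcomp Require Import all_classical all_reals all_analysis.

Set Implicit Arguments.
Unset Strict Implicit.
Unset Printing Implicit Defensive.

Import Order.TTheory GRing.Theory Num.Theory.

Local Open Scope classical_set_scope.
Local Open Scope ring_scope.

Section Graphs.
Variable V : choiceType.
Implicit Type E : rel V.

Definition simple_graph E := irreflexive E /\ symmetric E.

Definition connected_graph E :=
  forall u w : V, exists2 p : seq V, path E u p & last u p = w.

Definition bounded_degree E :=
  exists D : nat, forall u : V, ([set w | E u w] #<= `I_D)%card.

Definition graph_automorphism E (f : V -> V) :=
  bijective f /\ forall u w : V, E (f u) (f w) = E u w.

Definition quasi_transitive E :=
  exists (n : nat) (c : V -> 'I_n), forall u w : V, c u = c w ->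
    exists2 f : V -> V, graph_automorphism E f & f u = w.

End Graphs.

Definition graph_isomorphic (V W : choiceType) (E : rel V) (F : rel W) :=
  exists2 f : V -> W, bijective f & forall u w : V, F (f u) (f w) = E u w.

Definition Zpath : rel int := [rel u w | (w == u + 1) || (u == w + 1)].

Section WaterTransport.
Variables (R : realType) (V : choiceType).

(* An edge is given by an ordered pair of endpoints; the effect of a move does
   not depend on the order. *)
Record move := Move { move_src : V; move_dst : V; move_mu : R }.

Definition valid_move (E : rel V) (m : move) : bool :=
  E (move_src m) (move_dst m) && (0 < move_mu m <= 2^-1).

Definition apply_move (eta : V -> R) (m : move) : V -> R :=
  let: Move x y mu := m in
  fun w => if w == x then eta x + mu * (eta y - eta x)
           else if w == y then eta y + mu * (eta x - eta y)
           else eta w.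

Definition apply_moves (eta : V -> R) (ms : seq move) : V -> R :=
  foldl apply_move eta ms.

Definition achievable (E : rel V) (eta : V -> R) (v : V) : set R :=
  [set r | 0 <= r /\ exists2 ms : seq move,
     all (valid_move E) ms & apply_moves eta ms v = r].

Definition kappa (E : rel V) (eta : V -> R) (v : V) : R :=
  sup (achievable E eta v).

End WaterTransport.

Section Probability.
Context d (T : measurableType d) (R : realType) (P : probability T R).

Definition mutually_independent (I : choiceType) (X : I -> {RV P >-> R}) :=
  forall (s : seq I) (A : I -> set R), uniq s ->
    (forall i, measurable (A i)) ->
    P (\bigcap_(i in [set` s]) (X i @^-1` A i)) =
    (\prod_(i <- s) P (X i @^-1` A i))%E.

Definition uniform01 (X : {RV P >-> R}) :=
  forall A : set R, measurable A ->
    distribution P X A = uniform_prob (@ltr01 R) A.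

Definition support_of (X : T -> R) : set R :=
  [set r | forall eps : R, 0 < eps ->
     (0 < P [set t | (`|X t - r| < eps)%R])%E].

End Probability.

(* Main.v *)
Require Import Defs.
From HB Require Import structures.
From mathcomp Require Import all_boot all_order all_algebra.
From mathcomp Require Import all_classical all_reals all_analysis.
From mathcomp Require Import measurable_realfun ring lra zify.
Set Implicit Arguments.
Unset Strict Implicit.
Unset Printing Implicit Defensive.
Import Order.TTheory GRing.Theory Num.Theory.
Local Open Scope classical_set_scope.
Local Open Scope ring_scope.

(** Repeatedly averaging along a path makes it flat in the limit, so every
    weighting of the initial profile reached by such averagings bounds [kappa]
    from below.

    On a graph other than the line there are arbitrarily long geodesics from
    [v] along which vertices with a neighbour off the geodesic recur at bounded
    gaps.  If the [n]-th such neighbour has level at least [g], pouring it into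
    the geodesic and averaging multiplies the deficit [g - level] at [v] by
    about [1 - 1 / (C n)].  These factors are independent and the harmonic
    series diverges, so the expected product tends to [0].

    On the line, the final level at [0] is [\sum_u xi u * eta u], where [xi] is
    obtained from the unit mass at [0] by the reversed moves.  The weight [xi]
    is unimodal, and at its mode [p] it is at most [1 / (|p| + 1)].  By Abel
    summation only the averages of [eta] over windows at [p] of length
    comparable to [|p|] matter, and exponential tail bounds control these:
    far from [0] they are close to [1/2], which gives [kappa < 1], and asking in
    addition for low levels near [0] forces [kappa] close to [1/2].  Conversely,
    if [eta m > 1/2], averaging over a long interval ending at [m - 1] and then
    over [[0, m]] leaves weight [1 / (m + 1)] on [m] and spreads the rest
    evenly, so that [kappa > 1/2]. *)

(** * Real sequences *)

Section RealSequences.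
Variable R : realType.
Implicit Types (r c : R).

Lemma geometric_small c r (th : R) : 0 <= r -> r < 1 -> 0 < th ->
  exists n, c * r ^+ n < th.
Proof.
move=> r0 r1 th0; have : `|r| < 1 by rewrite ger0_norm.
move=> /(@cvg_geometric R c)/cvgrPdist_lt/(_ _ th0)[n _ /(_ n (leqnn n))].
by rewrite sub0r normrN => h; exists n; apply: le_lt_trans h; rewrite ler_norm.
Qed.

Lemma exprn_small r (th : R) : 0 <= r -> r < 1 -> 0 < th ->
  exists n, r ^+ n < th.
Proof.
by move=> r0 r1 /(geometric_small 1 r0 r1)[n]; rewrite mul1r; exists n.
Qed.

(** After division by [1 - r], the right side is a sum of [k] powers of [r], each at least [r ^+ k].
    So [k * r ^+ k] is bounded, which later absorbs the number of windows of length [k]. *)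
Lemma natmul_expr_le r k : 0 <= r -> r < 1 ->
  k%:R * r ^+ k * (1 - r) <= 1 - r ^+ k.
Proof.
move=> r0 r1; elim: k => [|k IH]; first by rewrite mul0r mul0r expr0 subrr.
have rk0 : 0 <= r ^+ k.+1 by rewrite exprn_ge0.
have rE : r ^+ k.+1 = r * r ^+ k := exprS r k.
have : r * (k%:R * r ^+ k * (1 - r)) <= r * (1 - r ^+ k) by rewrite ler_wpM2l.
have : 0 <= (1 - r) * (1 - r ^+ k.+1).
  by rewrite mulr_ge0 ?subr_ge0 ?exprn_ile1 ?(ltW r1).
rewrite -natr1; move: (k%:R : R) (r ^+ k) (r ^+ k.+1) rE => K A B ->; nra.
Qed.

Lemma geometric_tail r k0 n : 0 <= r -> r < 1 ->
  (\sum_(k < n) (if (k0 < k)%N then r ^+ k else 0)) * (1 - r) <= r ^+ k0.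
Proof.
move=> r0 r1.
(* The subtracted term carries the telescoped end [r ^+ n]; the strengthened bound is 0 as long as
   no term has been counted. *)
suff h : (\sum_(k < n) (if (k0 < k)%N then r ^+ k else 0)) * (1 - r) <=
    r ^+ k0 - (if (k0 < n)%N then r ^+ n else r ^+ k0).
  apply: le_trans h _; rewrite gerBl; by case: ifP => _; rewrite exprn_ge0.
elim: n => [|n IH]; first by rewrite big_ord0 mul0r ltn0 subrr.
rewrite big_ord_recr /= mulrDl; apply: le_trans (lerD IH (lexx _)) _.
have [kn|nk] := ltnP k0 n.
  by rewrite ltnS ltnW // exprS; lra.
rewrite subrr mul0r addr0 subr_ge0; case: ifP => // k0n.
by apply: ler_wiXn2l; [|exact: ltW|exact: ltnW].
Qed.

Lemma harmonic_unbounded (M : R) : exists n, M <= \sum_(i < n) (i.+1%:R)^-1.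
Proof.
apply: contrapT => /forallNP h; apply: (@dvg_harmonic R).
apply: nondecreasing_is_cvgn.
  apply/nondecreasing_seqP => n; rewrite /series /= big_nat_recr //= lerDl.
  by rewrite /harmonic /= invr_ge0.
exists M => _ [n _ <-]; rewrite /series /= big_mkord leNgt; apply/negP => lt.
exact: (h n (ltW lt)).
Qed.

(** Each factor satisfies [1 - y <= 1 / (1 + y)], and the product of the [1 + y] is at least one
    plus their sum. *)
Lemma prod_le_harmonic c n : 0 < c <= 1 ->
  \prod_(i < n) (1 - c / i.+1%:R) <= (1 + c * \sum_(i < n) (i.+1%:R)^-1)^-1.
Proof.
move=> /andP[c0 c1]; elim: n => [|n IH]; first by rewrite !big_ord0 mulr0 addr0 invr1.
rewrite !big_ord_recr /=; set S := \sum_(i < n) _ in IH *.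
have S0 : 0 <= S by apply: sumr_ge0 => i _; rewrite invr_ge0.
set y := n.+1%:R^-1; have y0 : 0 < y by rewrite invr_gt0 ltr0n.
have y1 : y <= 1 by rewrite invf_le1 ?ltr0n // ler1n.
have cy0 : 0 < c * y by rewrite mulr_gt0.
have cy1 : c * y <= 1 by rewrite mulr_ile1 // ltW.
have cS : 0 <= c * S by rewrite mulr_ge0 // ltW.
apply: (@le_trans _ _ ((1 + c * S)^-1 * (1 - c * y))).
  by rewrite ler_wpM2r // subr_ge0.
rewrite [c * (S + y)]mulrDr ler_pdivrMl; last lra.
by rewrite ler_pdivlMr; nra.
Qed.

(** From [expR (- y) >= 1 - y] follows [expR y <= 1 / (1 - y)], which is at most the quadratic for
    [|y| <= 1/2]. *)
Lemma expR_le_quad (y : R) : `|y| <= 2^-1 -> expR y <= 1 + y + 2 * y ^+ 2.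
Proof.
rewrite ler_norml => /andP[y1 y2].
have y3 : 0 < 1 - y by lra.
have e : expR y <= (1 - y)^-1.
  rewrite -[y in leLHS]opprK expRN lef_pV2 ?posrE ?expR_gt0 //.
  by have := expR_ge1Dx (- y).
apply: le_trans e _; rewrite -[leLHS]mul1r ler_pdivrMr //; nra.
Qed.

(** Summation by parts turns the left side into a combination of partial sums of [c], with
    nonnegative weights of total [a 0]. *)
Lemma abel_le (a c : nat -> R) (B : R) n : 0 <= B ->
  (forall j, 0 <= a j) -> (forall j, a j.+1 <= a j) ->
  (forall k, \sum_(j < k) c j <= B) ->
  \sum_(j < n) a j * c j <= a 0%N * B.
Proof.
move=> B0 a0 am cB.
(* The slack of the current partial sum, weighted by the last [a k], makes the bound inductive. *)
have aux k : \sum_(j < k.+1) a j * c j + a k * (B - \sum_(j < k.+1) c j) <= a 0%N * B.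
  elim: k => [|k IH]; first by rewrite !big_ord1; have := lexx (a 0%N * B); lra.
  rewrite big_ord_recr /= [X in B - X]big_ord_recr /=.
  have := cB k.+1; have := am k; move: IH.
  by set S := \sum_(j < _) c _; nra.
case: n => [|n]; first by rewrite big_ord0 mulr_ge0.
by apply: le_trans (aux n); rewrite lerDl mulr_ge0 // subr_ge0.
Qed.

End RealSequences.

(** * Moves *)

Section Moves.
Variables (R : realType) (V : choiceType) (E : rel V).
Implicit Types (eta zeta : V -> R) (m : move R V) (ms : seq (move R V)).

Lemma apply_moves_cons eta m ms :
  apply_moves eta (m :: ms) = apply_moves (apply_move eta m) ms.
Proof. by []. Qed.

Lemma apply_moves_cat eta ms ms' :
  apply_moves eta (ms ++ ms') = apply_moves (apply_moves eta ms) ms'.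
Proof. exact: foldl_cat. Qed.

(** For [0 < mu <= 1/2] every new level is a convex combination of old ones. *)
Lemma apply_move_mono eta zeta m : valid_move E m ->
  (forall w, zeta w <= eta w) ->
  forall w, apply_move zeta m w <= apply_move eta m w.
Proof.
case: m => x y mu /andP[_ /= /andP[mu0 mu1]] le w.
have := le x; have := le y; have := le w.
by case: ifP => _; [|case: ifP => _]; nra.
Qed.

Lemma apply_moves_mono eta zeta ms : all (valid_move E) ms ->
  (forall w, zeta w <= eta w) ->
  forall w, apply_moves zeta ms w <= apply_moves eta ms w.
Proof.
elim: ms eta zeta => [//|m ms IH] eta zeta /= /andP[vm vms] le w.
exact/IH/apply_move_mono.
Qed.

Lemma apply_moves_shift eta (c : R) ms w :
  apply_moves (fun u => eta u + c) ms w = apply_moves eta ms w + c.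
Proof.
elim: ms eta => [//|[x y mu] ms IH] eta.
rewrite !apply_moves_cons -IH; congr apply_moves; apply/funext => u /=.
by case: ifP => _; [|case: ifP => _]; ring.
Qed.

Lemma apply_moves_cst (c : R) ms w : apply_moves (fun _ : V => c) ms w = c.
Proof.
elim: ms => [//|[x y mu] ms IH]; rewrite apply_moves_cons -[RHS]IH.
congr apply_moves; apply/funext => u /=.
by case: ifP => _; [|case: ifP => _]; ring.
Qed.

Lemma apply_moves_ge eta (a : R) ms w : all (valid_move E) ms ->
  (forall u, a <= eta u) -> a <= apply_moves eta ms w.
Proof. by move=> vms ge; rewrite -[leLHS](apply_moves_cst a ms w) apply_moves_mono. Qed.

Lemma apply_moves_le eta (a : R) ms w : all (valid_move E) ms ->
  (forall u, eta u <= a) -> apply_moves eta ms w <= a.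
Proof. by move=> vms le; rewrite -[leRHS](apply_moves_cst a ms w) apply_moves_mono. Qed.

(* Lower approximation suffices for lower bounds on [kappa], since moves are
   monotone. *)
Definition reach eta zeta := forall dl : R, 0 < dl ->
  exists2 ms, all (valid_move E) ms &
    forall w, zeta w - dl <= apply_moves eta ms w.

Lemma reach_refl eta zeta : (forall w, zeta w <= eta w) -> reach eta zeta.
Proof. by move=> le dl dl0; exists [::] => //= w; have := le w; lra. Qed.

(** Moves are monotone and commute with adding a constant, so the error of the first stage passes
    unchanged through the second and the two errors add up. *)
Lemma reach_trans eta zeta zeta' : reach eta zeta -> reach zeta zeta' ->
  reach eta zeta'.
Proof.
move=> r1 r2 dl dl0; have dl2 : 0 < dl / 2 by lra.
have [ms1 v1 h1] := r1 _ dl2; have [ms2 v2 h2] := r2 _ dl2.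
exists (ms1 ++ ms2); first by rewrite all_cat v1.
move=> w; rewrite apply_moves_cat.
have /(_ w) := apply_moves_mono v2 h1.
by rewrite apply_moves_shift; have := h2 w; lra.
Qed.

Lemma reach_lim eta zeta :
  (forall dl : R, 0 < dl -> exists2 zeta', reach eta zeta' &
     forall w, zeta w - dl <= zeta' w) ->
  reach eta zeta.
Proof.
move=> h dl dl0; have dl2 : 0 < dl / 2 by lra.
have [zeta' r le] := h _ dl2; have [ms v1 h1] := r _ dl2.
by exists ms => // w; have := h1 w; have := le w; lra.
Qed.

Lemma reach_move eta m : valid_move E m -> reach eta (apply_move eta m).
Proof.
by move=> vm dl dl0; exists [:: m]; rewrite /= ?vm // => w; lra.
Qed.

Section Kappa.
Variables (eta : V -> R) (v : V).
Hypothesis eta01 : forall u, 0 <= eta u <= 1.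

Lemma achievable_has_sup : has_sup (achievable E eta v).
Proof.
split; first by exists (eta v); split; [case/andP: (eta01 v)|exists [::]].
exists 1 => _ [_ [ms vms <-]]; apply: apply_moves_le vms _ => u.
by case/andP: (eta01 u).
Qed.

Lemma kappa_ge_reach zeta : reach eta zeta -> zeta v <= kappa E eta v.
Proof.
move=> r; apply/ler_addgt0Pr => e e0; have [ms vms h] := r _ e0.
rewrite -lerBlDr; apply: le_trans (h v) _.
apply: ub_le_sup; first exact: (achievable_has_sup).2.
split; last by exists ms.
by apply: apply_moves_ge vms _ => u; case/andP: (eta01 u).
Qed.

Lemma kappa_le (b : R) :
  (forall ms, all (valid_move E) ms -> apply_moves eta ms v <= b) ->
  kappa E eta v <= b.
Proof.
move=> h; apply: ge_sup; first exact: (achievable_has_sup).1.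
by move=> _ [_ [ms vms <-]]; exact: h.
Qed.

Lemma kappa_le1 : kappa E eta v <= 1.
Proof.
apply: kappa_le => ms vms; apply: apply_moves_le vms _ => u.
by case/andP: (eta01 u).
Qed.

End Kappa.

(** * Averaging along a path *)

Section PathAverage.
Variable q : nat -> V.

Definition flat n (a : R) eta w :=
  if w \in [seq q i | i <- iota 0 n.+1] then a else eta w.

Let is_path n := forall i, (i < n)%N -> E (q i) (q i.+1).
Let inj_path n := forall i j, (i <= n)%N -> (j <= n)%N -> q i = q j -> i = j.

Lemma mem_path n i : (i <= n)%N -> q i \in [seq q i | i <- iota 0 n.+1].
Proof. by move=> le; apply: map_f; rewrite mem_iota. Qed.

Lemma flat_in n a eta i : (i <= n)%N -> flat n a eta (q i) = a.
Proof. by move=> le; rewrite /flat mem_path. Qed.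

Lemma path_last_notin n : inj_path n.+1 ->
  q n.+1 \notin [seq q i | i <- iota 0 n.+1].
Proof.
move=> inj; apply/negP => /mapP[i]; rewrite mem_iota add0n => /= lt eqi.
have := inj n.+1 i (leqnn _) _ eqi; lia.
Qed.

Let prof n eta (a b : R) w :=
  if w \in [seq q i | i <- iota 0 n.+1] then a
  else if w == q n.+1 then b else eta w.

(* Sharing equally across the last edge and then averaging the first [n + 1]
   vertices at least halves the difference. *)
Let prof_step n (IH : forall eta,
    reach eta (flat n ((\sum_(i < n.+1) eta (q i)) / n.+1%:R) eta))
    (pn : is_path n.+1) (inj : inj_path n.+1) eta a b :
  exists a' b', [/\ reach (prof n eta a b) (prof n eta a' b'),
    n.+1%:R * a' + b' = n.+1%:R * a + b & `|b' - a'| <= `|b - a| / 2].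
Proof.
set m := Move (q n) (q n.+1) (2^-1 : R).
have vm : valid_move E m.
  by rewrite /valid_move /= pn //= invr_gt0 ltr0n lexx.
set eta1 := apply_move (prof n eta a b) m.
have N1 := path_last_notin inj.
have qn : q n.+1 != q n by apply/eqP => e; have := inj n.+1 n (leqnn _) (leqnSn _) e; lia.
have pqn : prof n eta a b (q n) = a by rewrite /prof mem_path.
have pqn1 : prof n eta a b (q n.+1) = b by rewrite /prof (negbTE N1) eqxx.
have e1n : eta1 (q n) = (a + b) / 2.
  by rewrite /eta1 /= eqxx pqn pqn1; field.
have e1n1 : eta1 (q n.+1) = (a + b) / 2.
  by rewrite /eta1 /= eqxx (negbTE qn) pqn pqn1; field.
have e1i i : (i < n)%N -> eta1 (q i) = a.
  move=> lt; rewrite /eta1 /=.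
  case: eqP => [e|_]; first by have := inj i n (ltac:(lia)) (leqnSn _) e; lia.
  case: eqP => [e|_]; first by have := inj i n.+1 (ltac:(lia)) (leqnn _) e; lia.
  by rewrite /prof mem_path // ltnW.
have sum1 : \sum_(i < n.+1) eta1 (q i) = n%:R * a + (a + b) / 2.
  rewrite big_ord_recr /= e1n (eq_bigr (fun=> a)) => [|i _]; last exact: e1i.
  by rewrite sumr_const card_ord mulr_natl.
have n0 : (0 : R) < n.+1%:R by rewrite ltr0n.
exists ((n%:R * a + (a + b) / 2) / n.+1%:R), ((a + b) / 2); split.
- apply: reach_trans (reach_move _ vm) _; apply: reach_trans (IH _) _.
  rewrite -/eta1 sum1; apply: reach_refl => w; rewrite /prof /flat.
  case: ifP => [//|Nw]; case: eqP => [->|/eqP wn]; first by rewrite e1n1.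
  rewrite /eta1 /= (negbTE wn); case: eqP => [wE|_].
    by rewrite wE mem_path in Nw.
  by rewrite /prof Nw (negbTE wn).
- rewrite mulrC divfK ?gt_eqF //; rewrite -natr1; by field.
- have -> : (a + b) / 2 - (n%:R * a + (a + b) / 2) / n.+1%:R =
     (b - a) / 2 * (n%:R / n.+1%:R).
    rewrite -natr1; by field.
  rewrite normrM normrM [`|2^-1|]ger0_norm ?invr_ge0 //.
  rewrite -[leRHS]mulr1 ler_wpM2l // ?mulr_ge0 ?invr_ge0//.
  by rewrite ger0_norm ?divr_ge0 // ler_pdivrMr // mul1r ler_nat.
Qed.

Lemma reach_path_average n eta : is_path n -> inj_path n ->
  reach eta (flat n ((\sum_(i < n.+1) eta (q i)) / n.+1%:R) eta).
Proof.
elim: n eta => [|n IH] eta pn inj.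
  apply: reach_refl => w; rewrite big_ord1 divr1 /flat /= inE.
  by case: eqP => // ->.
have {}IH eta' : reach eta' (flat n ((\sum_(i < n.+1) eta' (q i)) / n.+1%:R) eta').
  apply: IH => [i lt|i j le1 le2]; first by apply: pn; lia.
  by apply: inj; lia.
set a := (\sum_(i < n.+1) eta (q i)) / n.+1%:R.
have n0 : (0 : R) < n.+1%:R by rewrite ltr0n.
set A := _ / n.+2%:R.
have AE : n.+2%:R * A = n.+1%:R * a + eta (q n.+1).
  by rewrite /A mulrC divfK ?pnatr_eq0 // big_ord_recr /= /a mulrC divfK // gt_eqF.
clearbody A.
(* Repeated steps keep the total mass [n.+2 * A] and halve the gap, so both values tend to the
   average [A]. *)
have iterP k : exists a' b', [/\ reach eta (prof n eta a' b'),
    n.+1%:R * a' + b' = n.+2%:R * A & `|b' - a'| <= `|eta (q n.+1) - a| * 2^-1 ^+ k].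
  elim: k => [|k [a1 [b1 [r1 e1 d1]]]].
    exists a, (eta (q n.+1)); split => //; last by rewrite expr0 mulr1.
    apply: reach_trans (IH eta) _; apply: reach_refl => w.
    by rewrite /prof /flat -/a; case: ifP => // _; case: eqP => // ->.
  have [a2 [b2 [r2 e2 d2]]] := prof_step IH pn inj eta a1 b1.
  exists a2, b2; split; [exact: reach_trans r2|by rewrite e2|].
  by apply: le_trans d2 _; rewrite exprSr; lra.
apply: reach_lim => dl dl0.
have [k kP] : exists k, `|eta (q n.+1) - a| * 2^-1 ^+ k < dl.
  by apply: geometric_small => //; lra.
have [a1 [b1 [r1 e1 d1]]] := iterP k.
exists (prof n eta a1 b1) => // w; rewrite /flat /prof.
(* [A] is a weighted mean of [a1] and [b1]; as these differ by less than [dl], both exceed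
   [A - dl]. *)
have : `|b1 - a1| < dl by apply: le_lt_trans kP.
rewrite ltr_norml => /andP[d3 d4]; rewrite -natr1 in e1.
have n1 : (0 : R) <= n%:R by rewrite ler0n.
have n2 : n.+2%:R = n%:R + 2 :> R by rewrite -natrD addn2.
rewrite n2 in e1.
clear -n1 e1 d3 d4 dl0 r1; move: (n%:R : R) n1 e1 => x n1 e1.
have -> : (w \in [seq q i | i <- iota 0 n.+2]) =
   (w \in [seq q i | i <- iota 0 n.+1]) || (w == q n.+1).
  by rewrite -[n.+2]addn1 iotaD map_cat mem_cat add0n mem_seq1.
have n3 := mulr_ge0 n1 (ltW dl0).
case: (w \in [seq q i | i <- iota 0 n.+1]) => /=.
  by case: (lerP (A - dl) a1) => // h; nra.
case: (w == q n.+1); last by lra.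
by case: (lerP (A - dl) b1) => // h; nra.
Qed.

End PathAverage.

End Moves.

(** * Pouring from side vertices into a path *)

Section Stations.
Variables (R : realType) (V : choiceType) (E : rel V) (q : nat -> V) (L : nat).
Variables (eta : V -> R) (g : R).
Hypothesis q_path : forall i, (i < L)%N -> E (q i) (q i.+1).
Hypothesis q_inj : forall i j, (i <= L)%N -> (j <= L)%N -> q i = q j -> i = j.
Hypothesis eta_ge0 : forall w, 0 <= eta w.

(** A station is a position [j] on the path with a side neighbour of [q j]. The product is the
    fraction of [g] still lacking once all stations are used: sharing half of a level at least [g]
    with [q j] and averaging the [j + 1] vertices up to it multiplies the deficit by at most
    [1 - 1 / (2 (j + 1))]. *)
Definition missing (st : seq (nat * V)) : R :=
  \prod_(s <- st) (if g <= eta s.2 then 1 - (2 * s.1.+1%:R)^-1 else 1).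

(* The stations are used from the far end of the path to the near one: after
   a station has been used, the path up to it is averaged. *)
Lemma stations_reach st j0 :
  sorted ltn (map fst st) -> uniq (map snd st) -> (j0 <= L)%N -> 0 <= g ->
  {in st, forall s, [/\ (j0 <= s.1 <= L)%N, E (q s.1) s.2 &
     forall i, (i <= L)%N -> s.2 <> q i]} ->
  exists zeta, [/\ reach E eta zeta, forall w, 0 <= zeta w,
    forall l, (l <= j0)%N -> g * (1 - missing st) <= zeta (q l) &
    forall w, (forall i, (i <= L)%N -> w <> q i) -> w \notin map snd st ->
      eta w <= zeta w].
Proof.
move=> + + + g0; elim: st j0 => [|[j u] st IH] j0 /= srt unq j0L hst.
  exists eta; split => //; first exact: reach_refl.
  by move=> l _; rewrite /missing big_nil subrr mulr0.
case/andP: unq => u_notin unq.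
have [/= /andP[j0j jL] Eju off_u] := hst (j, u) (mem_head _ _).
have jlt i : (i < j)%N -> (i < L)%N by move=> ij; apply: leq_trans jL.
have jle i : (i <= j)%N -> (i <= L)%N by move=> ij; apply: leq_trans jL.
have qj i : (i < j)%N -> (q i == q j) = false.
  move=> ij; apply/eqP => e; have := q_inj (ltnW (jlt _ ij)) jL e.
  by move=> ji; rewrite ji ltnn in ij.
(* The farther stations come first and fill the path up to [j]. The last clause ensures that [u]
   still holds its initial water. *)
have [zeta [r z0 zl zoff]] : exists zeta, [/\ reach E eta zeta,
    forall w, 0 <= zeta w,
    forall l, (l <= j)%N -> g * (1 - missing st) <= zeta (q l) &
    forall w, (forall i, (i <= L)%N -> w <> q i) -> w \notin map snd st ->
      eta w <= zeta w].
  apply: IH => //; first exact: path_sorted srt.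
  move=> s sst; have [|/andP[_ ?] ? ?] := hst s; first by rewrite inE sst orbT.
  split=> //; apply/andP; split => //; apply: ltnW.
  have /allP := order_path_min (@ltn_trans) srt; apply; exact: map_f.
have missE : missing ((j, u) :: st) =
    (if g <= eta u then 1 - (2 * j.+1%:R)^-1 else 1) * missing st.
  by rewrite /missing big_cons.
case: ifP missE => gu missE; last first.
  exists zeta; split => //.
    by move=> l lj; rewrite missE mul1r; apply: zl; apply: leq_trans j0j.
  by move=> w woff; rewrite inE negb_or => /andP[_]; apply: zoff.
set m := Move (q j) u (2^-1 : R).
have vm : valid_move E m by rewrite /valid_move /= Eju invr_gt0 ltr0n lexx.
set z1 := apply_move zeta m.
have z1_ge0 w : 0 <= z1 w.
  by apply: (@apply_moves_ge _ _ E _ _ [:: m]) => //=; rewrite vm.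
set a := g * (1 - missing st).
set avg := (\sum_(i < j.+1) z1 (q i)) / j.+1%:R.
have j1 : (0 : R) < j.+1%:R by rewrite ltr0n.
have uq : (u == q j) = false by apply/eqP; exact: off_u.
have z1j : (a + g) / 2 <= z1 (q j).
  rewrite /z1 /= eqxx; have := zl j (leqnn j); have := zoff u off_u u_notin.
  by rewrite -/a; lra.
have z1i i : (i < j)%N -> a <= z1 (q i).
  move=> ij; rewrite /z1 /= qj //.
  case: eqP => [e|_]; last by apply: zl; apply: ltnW.
  by case: (off_u i (jle _ (ltnW ij))).
(* With [j] vertices at [a] or more and [q j] at [(a + g) / 2] or more, the deficit [g - a] shrinks
   by the factor [1 - 1 / (2 (j + 1))]. *)
have avg_ge : g * (1 - missing ((j, u) :: st)) <= avg.
  rewrite /avg ler_pdivlMr //.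
  have -> : g * (1 - missing ((j, u) :: st)) * j.+1%:R = j%:R * a + (a + g) / 2.
    by rewrite missE /a -natr1; by field.
  rewrite big_ord_recr /= lerD //.
  have -> : j%:R * a = \sum_(i < j) a by rewrite sumr_const card_ord mulr_natl.
  by apply: ler_sum => i _; apply: z1i.
exists (flat q j avg z1); split.
- apply: reach_trans r _; apply: reach_trans (reach_move _ vm) _.
  apply: reach_path_average => [i ij|i i' ij i'j].
    exact: q_path (jlt _ ij).
  exact: q_inj (jle _ ij) (jle _ i'j).
- move=> w; rewrite /flat; case: ifP => _ //.
  by rewrite divr_ge0 // sumr_ge0.
- by move=> l lj0; rewrite flat_in //; apply: leq_trans j0j.
- move=> w woff; rewrite inE negb_or => /andP[wu wst].
  rewrite /flat; case: ifP => [/mapP[i]|_].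
    by rewrite mem_iota => /= ij wq; case: (woff i) => //; apply: jle.
  rewrite /z1 /= (negbTE wu); case: eqP => [e|_]; first by case: (woff j).
  exact: zoff.
Qed.

Lemma kappa_ge_stations st : (forall w, eta w <= 1) ->
  sorted ltn (map fst st) -> uniq (map snd st) -> 0 <= g ->
  {in st, forall s, [/\ (s.1 <= L)%N, E (q s.1) s.2 &
     forall i, (i <= L)%N -> s.2 <> q i]} ->
  g * (1 - missing st) <= kappa E eta (q 0).
Proof.
move=> eta1 srt unq g0 hst.
have [zeta [r _ zl _]] := stations_reach srt unq (leq0n L) g0 hst.
apply: le_trans (zl 0 (leqnn 0)) _; apply: kappa_ge_reach r => u.
by rewrite eta_ge0 eta1.
Qed.

End Stations.

(** * Approximation by rational moves *)

Section RationalMoves.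
Variables (R : realType) (V : choiceType) (E : rel V).

Definition rational_move (x : V * V * rat) : move R V :=
  Move x.1.1 x.1.2 (ratr x.2).

(** The effect of a move is Lipschitz in [mu], and later moves do not amplify a uniform error. Over
    a countable vertex set this leaves countably many move sequences, whence the measurability of
    [kappa]. *)
Lemma rational_moves_dense (eta : V -> R) ms (dl : R) :
  all (valid_move E) ms -> 0 < dl ->
  exists2 s : seq (V * V * rat), all (valid_move E) (map rational_move s) &
    forall w, apply_moves eta ms w - dl <= apply_moves eta (map rational_move s) w.
Proof.
elim: ms eta dl => [|m ms IH] eta dl /=.
  by move=> _ dl0; exists [::] => //= w; lra.
case/andP=> vm vms dl0.
have dl2 : 0 < dl / 2 by lra.
have [s vs hs] := IH (apply_move eta m) (dl / 2) vms dl2.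
case: m vm hs => x y mu vm hs; have /andP[/= Exy /andP[mu0 mu1]] := vm.
set D := eta y - eta x.
have D1 : 0 < `|D| + 1 by rewrite ltr_wpDl.
set e := dl / 2 / (`|D| + 1).
have e0 : 0 < e by rewrite divr_gt0.
(* Approximating [mu] from below keeps the rational at most 1/2; the maximum with 0 keeps it
   positive. *)
have max_mu : Num.max 0 (mu - e) < mu by rewrite gt_max mu0 ltrBlDr ltrDl e0.
have [p] := rat_in_itvoo max_mu.
rewrite in_itv /= gt_max => /andP[/andP[p0 pe] pmu].
have le w : apply_move eta (Move x y mu) w - dl / 2 <=
            apply_move eta (Move x y (ratr p)) w.
  have DE : `|D| * (mu - ratr p) <= dl / 2.
    have -> : dl / 2 = (`|D| + 1) * e by rewrite /e [RHS]mulrC divfK // gt_eqF.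
    by apply: ler_pM => //; [lra|lra|lra].
  have : `|D * (mu - ratr p)| <= dl / 2.
    by rewrite normrM [`|mu - _|]ger0_norm //; lra.
  rewrite ler_norml => /andP[d1 d2].
  rewrite /=; case: ifP => _; first by rewrite -/D; lra.
  by case: ifP => _; last lra; rewrite /D in d1 d2; lra.
exists ((x, y, p) :: s).
  by rewrite /= vs andbT /valid_move /= Exy p0 /=; lra.
move=> w; rewrite map_cons apply_moves_cons.
have /(_ w) := apply_moves_mono vs le.
by rewrite apply_moves_shift /rational_move /=; have := hs w; lra.
Qed.

End RationalMoves.

Section Isomorphism.
Variables (R : realType) (V W : choiceType) (E : rel V) (F : rel W).
Variables (h : W -> V).
Hypothesis h_bij : bijective h.
Hypothesis h_iso : forall a b, E (h a) (h b) = F a b.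

Lemma apply_moves_iso (eta : V -> R) ms a :
  apply_moves eta [seq Move (h (move_src m)) (h (move_dst m)) (move_mu m) | m <- ms]
    (h a) = apply_moves (eta \o h) ms a.
Proof.
elim: ms eta => [//|[x y mu] ms IH] eta.
rewrite map_cons !apply_moves_cons IH; congr apply_moves.
by apply/funext => u /=; rewrite !(bij_eq h_bij).
Qed.

Lemma kappa_iso (eta : V -> R) a : kappa E eta (h a) = kappa F (eta \o h) a.
Proof.
congr sup; apply/seteqP; split => r [r0 [ms vms e]]; split=> //.
- have [h' hK h'K] := h_bij.
  exists [seq Move (h' (move_src m)) (h' (move_dst m)) (move_mu m) | m <- ms].
    rewrite all_map; apply: sub_all vms => m /=.
    by rewrite /valid_move /= -h_iso !h'K.
  rewrite -e -apply_moves_iso -map_comp; congr apply_moves.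
  by rewrite -[RHS]map_id; apply: eq_map => -[x y mu] /=; rewrite !h'K.
- eexists; last by rewrite -e; exact: apply_moves_iso.
  by rewrite all_map; apply: sub_all vms => m; rewrite /valid_move /= h_iso.
Qed.

End Isomorphism.

(** * Duality of moves *)

Section Duality.
Variables (R : realType) (V : choiceType).
Implicit Types (xi eta : V -> R) (m : move R V).

(** With [D] the difference of the two unit masses at the endpoints, a move is the symmetric
    operator [1 - mu D D^T]. The formula also covers equal endpoints, where [D = 0]. *)
Lemma apply_moveE eta m u :
  apply_move eta m u = eta u + move_mu m * (eta (move_dst m) - eta (move_src m)) *
    ((u == move_src m)%:R - (u == move_dst m)%:R).
Proof.
case: m => x y mu /=; case: (eqVneq u x) => [->|_].
  by case: (eqVneq x y) => [->|_]; rewrite ?subrr ?mulr0 ?addr0 ?subr0 ?mulr1.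
by case: (eqVneq u y) => [->|_]; rewrite ?subrr ?mulr0 ?addr0 //= sub0r; ring.
Qed.

Lemma sum_pick (s : seq V) (f : V -> R) x : uniq s -> x \in s ->
  \sum_(u <- s) (u == x)%:R * f u = f x.
Proof.
move=> us xs; rewrite (bigD1_seq x) //= eqxx mul1r big1 ?addr0 // => u /negbTE ->.
by rewrite mul0r.
Qed.

Lemma apply_move_adjoint xi eta m (s : seq V) : uniq s ->
  move_src m \in s -> move_dst m \in s ->
  \sum_(u <- s) apply_move xi m u * eta u = \sum_(u <- s) xi u * apply_move eta m u.
Proof.
case: m => x y mu us xs ys.
pose S := \sum_(u <- s) xi u * eta u.
have D f h (c : R) : \sum_(u <- s) (f u + c * ((u == x)%:R - (u == y)%:R)) * h u =
    \sum_(u <- s) f u * h u + c * (h x - h y).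
  rewrite -(sum_pick h us xs) -(sum_pick h us ys) -sumrB mulr_sumr -big_split /=.
  by apply: eq_bigr => u _; ring.
under eq_bigr do rewrite apply_moveE /=.
under [RHS]eq_bigr do rewrite apply_moveE /= mulrC.
rewrite !D; under [in RHS]eq_bigr do rewrite mulrC.
by congr (_ + _); ring.
Qed.

(** Each move is self-adjoint, so the adjoint of a sequence is the reversed sequence. With [xi] a
    unit mass, the final level at one vertex becomes a weighting of the initial profile. *)
Lemma apply_moves_adjoint xi eta (ms : seq (move R V)) (s : seq V) : uniq s ->
  all (fun m => (move_src m \in s) && (move_dst m \in s)) ms ->
  \sum_(u <- s) apply_moves xi (rev ms) u * eta u =
  \sum_(u <- s) xi u * apply_moves eta ms u.
Proof.
move=> us; elim: ms eta => [//|m ms IH] eta /= /andP[/andP[sm dm] hs].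
by rewrite rev_cons -cats1 apply_moves_cat /= apply_move_adjoint // IH.
Qed.

End Duality.

(** * Geodesics in quasi-transitive graphs *)

Section Walks.
Variables (V : choiceType) (E : rel V).

Fixpoint walk (n : nat) (u w : V) : Prop :=
  if n is n'.+1 then exists2 x, E u x & walk n' x w else u = w.

Lemma walk_cat m n u x w : walk m u x -> walk n x w -> walk (m + n) u w.
Proof.
elim: m u => [|m IH] u /= => [->//|[y Euy h] h2].
by exists y => //; apply: IH.
Qed.

Lemma walk1 u w : E u w -> walk 1 u w.
Proof. by exists w. Qed.

Lemma walk_fun n u w : walk n u w -> exists q : nat -> V,
  [/\ q 0%N = u, q n = w & forall i, (i < n)%N -> E (q i) (q i.+1)].
Proof.
elim: n u => [|n IH] u /= => [->|[y Euy /IH[q [q0 qn qE]]]].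
  by exists (fun=> w).
exists (fun i => if i is i'.+1 then q i' else u); split => // -[|i] lt.
  by rewrite q0.
exact: qE.
Qed.

Lemma fun_walk (q : nat -> V) n i j :
  (forall i, (i < n)%N -> E (q i) (q i.+1)) -> (i <= j <= n)%N ->
  walk (j - i) (q i) (q j).
Proof.
move=> qE /andP[ij jn]; rewrite -{2}(subnKC ij).
have: (i + (j - i) <= n)%N by lia.
move: (j - i)%N => k {ij}; elim: k i => [|k IH] i le /=; first by rewrite addn0.
exists (q i.+1); first by apply: qE; lia.
by rewrite addnS -addSn; apply: IH; lia.
Qed.

(** Stated by lower bounds on the lengths of walks, so that no distance function is needed. *)
Definition geodesic (q : nat -> V) L :=
  (forall i, (i < L)%N -> E (q i) (q i.+1)) /\
  (forall i j m, (i <= L)%N -> (j <= L)%N -> walk m (q i) (q j) -> (j <= i + m)%N).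

Lemma geodesic_inj q L i j : geodesic q L ->
  (i <= L)%N -> (j <= L)%N -> q i = q j -> i = j.
Proof.
move=> [_ g] iL jL e; have := g i j 0%N iL jL e.
by have := g j i 0%N jL iL (esym e); lia.
Qed.

Hypothesis conn : connected_graph E.

Lemma connected_walk u w : exists n, walk n u w.
Proof.
have [p pp <-] := conn u w; exists (size p).
by elim: p u pp => [//|x p IH] u /= /andP[Eux /IH ?]; exists x.
Qed.

Lemma connected_ind (S : V -> Prop) u : S u ->
  (forall x y, S x -> E x y -> S y) -> forall w, S w.
Proof.
move=> Su cl w; have [n] := connected_walk u w.
by elim: n u Su => [|n IH] u Su /= => [<-//|[x /(cl _ _ Su)/IH]]; apply.
Qed.

Section BoundedDegree.
Hypothesis deg : bounded_degree E.

Lemma finite_sphere n u : finite_set [set w | walk n u w].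
Proof.
elim: n u => [|n IH] u.
  by rewrite (_ : [set w | _] = [set u]) //; apply/seteqP; split => w /=.
rewrite (_ : [set w | _] = \bigcup_(x in [set x | E u x]) [set w | walk n x w]).
  apply: bigcup_finite => [|x _]; last exact: IH.
  by have [D /(_ u) h] := deg; apply: card_le_finite h _.
by apply/seteqP; split => w /= [x]; exists x.
Qed.

Lemma countable_vertices : V -> countable [set: V].
Proof.
move=> v; rewrite (_ : setT = \bigcup_n [set w | walk n v w]).
  by apply: bigcup_countable => // n _; apply: finite_set_countable; apply: finite_sphere.
by apply/seteqP; split => w // _; have [n h] := connected_walk v w; exists n.
Qed.

Hypothesis inf : infinite_set [set: V].

(** Balls are finite by bounded degree, whereas the graph is infinite. *)
Lemma far_vertex v N : exists w, forall m, (m <= N)%N -> ~ walk m v w.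
Proof.
apply: contrapT => /forallNP h; apply: inf.
rewrite (_ : setT = \bigcup_(n in `I_N.+1) [set w | walk n v w]).
  by apply: bigcup_finite => // n _; exact: finite_sphere.
apply/seteqP; split => w // _; apply: contrapT => nw.
by apply: (h w) => m mN wm; apply: nw; exists m.
Qed.

(** A shortest walk to a far vertex: a shortcut between two of its points would shorten the whole
    walk. *)
Lemma geodesic_exists v N : exists L q,
  [/\ (N <= L)%N, q 0%N = v & geodesic q L].
Proof.
have [w far] := far_vertex v N.
have ex : exists n, `[< walk n v w >].
  by have [n h] := connected_walk v w; exists n; apply/asboolP.
case: (ex_minnP ex) => L /asboolP wL Lmin.
have [q [q0 qL qE]] := walk_fun wL.
exists L, q; split => //.
  by rewrite leqNgt; apply/negP => LN; apply: (far L) => //; apply: ltnW.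
split => // i j m iL jL wm.
have w1 : walk i v (q i).
  by have := @fun_walk q L 0 i qE; rewrite subn0 q0; apply; rewrite iL.
have w2 : walk (L - j) (q j) w by rewrite -qL; apply: (fun_walk qE); rewrite jL leqnn.
have := Lmin _ (asboolT (walk_cat (walk_cat w1 wm) w2)); lia.
Qed.

Section QuasiTransitive.
Hypothesis trans : quasi_transitive E.

Lemma walk_automorphism f n u w : graph_automorphism E f -> walk n u w ->
  walk n (f u) (f w).
Proof.
move=> [_ fE]; elim: n u => [|n IH] u /= => [->//|[x Eux /IH h]].
by exists (f x) => //; rewrite fE.
Qed.

(** One representative of each class reaches [w0] by some walk; automorphisms carry this walk to
    every vertex of the class, and there are finitely many classes. *)
Lemma invariant_dense (Q : V -> Prop) w0 : Q w0 ->
  (forall f w, graph_automorphism E f -> Q w -> Q (f w)) ->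
  exists r, forall u, exists w m, [/\ (m <= r)%N, walk m u w & Q w].
Proof.
move=> Qw0 Qinv; have [n [c hc]] := trans.
have h (i : 'I_n) : exists m, forall u, c u = i -> exists2 w, walk m u w & Q w.
  have [[r cr]|no] := pselect (exists r, c r = i); last first.
    by exists 0%N => u cu; case: no; exists u.
  have [m wm] := connected_walk r w0; exists m => u cu.
  have [f fa fu] := hc r u (etrans cr (esym cu)).
  exists (f w0); last exact: Qinv.
  by rewrite -fu; apply: walk_automorphism.
have [f fP] := choice h.
exists (\max_(i < n) f i) => u; have [w ww Qw] := fP (c u) u erefl.
by exists w, (f (c u)); split => //; apply: leq_bigmax.
Qed.

Hypothesis simple : simple_graph E.

Lemma edge_sym u w : E u w -> E w u.
Proof. by case: simple => _ s; rewrite s. Qed.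

Lemma geodesic_edge q L i j : geodesic q L -> (i <= L)%N -> (j <= L)%N ->
  E (q i) (q j) -> i = j.+1 \/ j = i.+1.
Proof.
move=> gq iL jL Eij; have [_ g] := gq.
have h1 := g i j 1%N iL jL (walk1 Eij).
have h2 := g j i 1%N jL iL (walk1 (edge_sym Eij)).
have : i <> j by move=> e; rewrite e simple.1 in Eij.
lia.
Qed.

(** Near [k] the vertices [q j] have no neighbours off [q], so each step changes the index by at
    most one. [d] bounds the current offset from [k], and [d + m <= r] leaves room for the remaining
    steps. *)
Lemma walk_stays q k r w (m d s : nat) :
  (forall j, (k <= j + r)%N -> (j <= k + r)%N ->
     forall u, E (q j) u -> u = q j.+1 \/ u = q j.-1) ->
  (k <= s + d)%N -> (s <= k + d)%N -> (d + m <= r)%N -> walk m (q s) w ->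
  exists j, [/\ (k <= j + r)%N, (j <= k + r)%N & w = q j].
Proof.
move=> h; elim: m d s => [|m IH] d s h1 h2 h3 /=.
  by move=> <-; exists s; split => //; lia.
case=> x Ex wx.
have [||xE|xE] := h s _ _ x Ex; [lia|lia| |]; rewrite xE in wx.
  by apply: (IH d.+1 s.+1) wx; lia.
by apply: (IH d.+1 s.-1) wx; lia.
Qed.

Definition branching w := exists a b c,
  [/\ E w a, E w b & E w c] /\ [/\ a <> b, a <> c & b <> c].

Lemma branching_invariant f w : graph_automorphism E f ->
  branching w -> branching (f w).
Proof.
move=> [fb fE] [a [b [c [[Ea Eb Ec] [ab ac bc]]]]].
exists (f a), (f b), (f c); rewrite !fE; split=> //.
by split => /(bij_inj fb).
Qed.

(** Otherwise a short walk from [q k] to a branching vertex would stay on the geodesic, where each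
    vertex has only its two path neighbours. *)
Lemma geodesic_station q L r k : geodesic q L ->
  (forall u, exists w m, [/\ (m <= r)%N, walk m u w & branching w]) ->
  (r < k)%N -> (k + r < L)%N ->
  exists ju : nat * V, [/\ (k <= ju.1 + r)%N, (ju.1 <= k + r)%N, E (q ju.1) ju.2 &
    forall i, (i <= L)%N -> ju.2 <> q i].
Proof.
move=> gq near rk kL; apply: contrapT => /forallNP no.
have h j : (k <= j + r)%N -> (j <= k + r)%N ->
    forall u, E (q j) u -> u = q j.+1 \/ u = q j.-1.
  move=> h1 h2 u Eu.
  have [[i [iL e]]|nu] := pselect (exists i, (i <= L)%N /\ u = q i); last first.
    by case: (no (j, u)); split => // i iL e; apply: nu; exists i.
  rewrite e in Eu *; have [||e2|->] := geodesic_edge gq _ _ Eu; [lia|lia| |].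
    by right; rewrite e2.
  by left.
have [w [m [mr wm [a [b [c [[Ea Eb Ec] [ab ac bc]]]]]]]] := near (q k).
have [||j [h1 h2 e]] := walk_stays (d := 0) h _ _ mr wm; [lia|lia|].
rewrite e in Ea Eb Ec.
by case: (h j h1 h2 _ Ea) => ?; case: (h j h1 h2 _ Eb) => ?;
  case: (h j h1 h2 _ Ec) => ?; congruence.
Qed.

(* Consecutive stations sit at distance at least three on the geodesic, so
   that no vertex off the geodesic serves two of them. *)
Lemma stations_exist v : (exists w, branching w) -> exists C : nat, forall N,
  exists L q (st : seq (nat * V)),
  [/\ q 0%N = v, geodesic q L &
   [/\ size st = N, sorted ltn (map fst st), uniq (map snd st),
     forall i s0, (i < N)%N -> ((nth s0 st i).1 < i.+1 * C)%N &
     {in st, forall s, [/\ (s.1 <= L)%N, E (q s.1) s.2 &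
       forall i, (i <= L)%N -> s.2 <> q i]}]].
Proof.
move=> [w0 b0]; have [r near] := invariant_dense b0 branching_invariant.
(* Stations are sought within [r] of the centres [k i], which are [C] apart; this leaves a distance
   of three between consecutive search ranges. *)
pose C := (2 * r + 3)%N; exists C => N.
have [L [q [NL q0 gq]]] := geodesic_exists v (N.+1 * C)%N.
pose k i := (r.+1 + i * C)%N.
have ex i : exists ju : nat * V, (i < N)%N ->
    [/\ (k i <= ju.1 + r)%N, (ju.1 <= k i + r)%N, E (q ju.1) ju.2 &
    forall i, (i <= L)%N -> ju.2 <> q i].
  have [lt|ge] := ltnP i N; last by exists (0%N, v).
  have [||ju juP] := @geodesic_station q L r (k i) gq near; last by exists ju.
    by rewrite /k; lia.
  have : (i.+2 * C <= N.+1 * C)%N by rewrite leq_mul2r; lia.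
  by rewrite /k !mulSn /C in NL *; lia.
have [f fP] := choice ex.
exists L, q, [seq f i | i <- iota 0 N]; split => //; split.
- by rewrite size_map size_iota.
- rewrite -map_comp; apply: (@homo_sorted_in _ _ (fun i => (i < N)%N) _ ltn).
  + move=> i j iN jN ij; have [_ h1 _ _] := fP i iN; have [h2 _ _ _] := fP j jN.
    have : (i.+1 * C <= j * C)%N by rewrite leq_mul2r; move: ij => /=; lia.
    by rewrite /k mulSn /C /= in h1 h2 *; lia.
  + by apply/allP => i; rewrite mem_iota.
  + exact: iota_ltn_sorted.
- rewrite -map_comp map_inj_in_uniq ?iota_uniq // => i j; rewrite !mem_iota /=.
  move=> iN jN e; have [h1 h2 Ei _] := fP i iN; have [h3 h4 Ej _] := fP j jN.
  have [_ g] := gq.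
  have kk a : (a < N)%N -> (k a + r <= L)%N.
    move=> aN; have : (a.+1 * C <= N.+1 * C)%N by rewrite leq_mul2r; lia.
    by rewrite /k !mulSn /C in NL *; lia.
  (* A shared side vertex would join the two positions by a walk of length two. *)
  have w1 : walk 2 (q (f i).1) (q (f j).1).
    exists (f i).2 => //; exists (q (f j).1) => //; apply: edge_sym.
    by rewrite e.
  have w2 : walk 2 (q (f j).1) (q (f i).1).
    exists (f j).2 => //; exists (q (f i).1) => //; apply: edge_sym.
    by rewrite -e.
  have l1 := kk i iN; have l2 := kk j jN.
  have d1 := g _ _ _ (leq_trans h2 l1) (leq_trans h4 l2) w1.
  have d2 := g _ _ _ (leq_trans h4 l2) (leq_trans h2 l1) w2.
  case: (ltngtP i j) => // lt.
    have : (i.+1 * C <= j * C)%N by rewrite leq_mul2r; lia.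
    by rewrite /k mulSn /C in h1 h2 h3 h4 *; lia.
  have : (j.+1 * C <= i * C)%N by rewrite leq_mul2r; lia.
  by rewrite /k mulSn /C in h1 h2 h3 h4 *; lia.
- move=> i s0 iN; rewrite (nth_map 0%N) ?size_iota // nth_iota // add0n.
  by have [_ h _ _] := fP i iN; rewrite /k mulSn /C in h *; lia.
- move=> s /mapP[i]; rewrite mem_iota => /= iN ->; have [_ h Ei off] := fP i iN.
  split => //; apply: leq_trans h _.
  have : (i.+1 * C <= N.+1 * C)%N by rewrite leq_mul2r; lia.
  by rewrite /k !mulSn /C in NL *; lia.
Qed.

(** * Graphs without branching vertices are lines *)

Section NoBranching.
Hypothesis nobranch : forall w, ~ branching w.

Lemma nbr2 w a b c : E w a -> E w b -> a <> b -> E w c -> c = a \/ c = b.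
Proof.
move=> Ea Eb ab Ec; apply: contrapT => /not_orP[ca cb].
by apply: (nobranch (w := w)); exists a, b, c; do !split => //; apply: nesym.
Qed.

(* An end vertex would lie close to the middle of a long geodesic, whose
   inner vertices have no neighbours off the geodesic. *)
Lemma no_end_vertex w0 : ~ (forall a b, E w0 a -> E w0 b -> a = b).
Proof.
move=> end0.
have [r near] := invariant_dense (Q := fun w => forall a b, E w a -> E w b -> a = b)
  end0 (ltac:(
    move=> f w [[f' fK f'K] fE] h a b;
    rewrite -(f'K a) -(f'K b) !fE => Ea Eb; by rewrite (h _ _ Ea Eb))).
(* This length makes every index within [r] of [r + 1] an inner one. *)
have [L [q [NL _ gq]]] := geodesic_exists w0 (2 * r + 3).
have inner j : (0 < j < L)%N ->
    [/\ E (q j) (q j.+1), E (q j) (q j.-1) & q j.+1 <> q j.-1].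
  move=> /andP[j0 jL]; have [gE _] := gq; split.
  - exact: gE.
  - by apply: edge_sym; rewrite -{2}(prednK j0); apply: gE; lia.
  - by move=> e; have := @geodesic_inj q L j.+1 j.-1 gq jL (ltac:(lia)) e; lia.
have h j : (r.+1 <= j + r)%N -> (j <= r.+1 + r)%N ->
    forall u, E (q j) u -> u = q j.+1 \/ u = q j.-1.
  move=> h1 h2 u Eu; have [|e1 e2 ne] := inner j; first lia.
  exact: nbr2 e1 e2 ne Eu.
have [w [m [mr wm hw]]] := near (q r.+1).
have [||j [h1 h2 e]] := walk_stays (d := 0) h _ _ mr wm; [lia|lia|].
have [|e1 e2 ne] := inner j; first lia.
by rewrite e in hw; apply: ne; apply: hw.
Qed.

(** Without end vertices a walk can always continue without turning back; two such rays leave [v]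
    through different neighbours. *)
Lemma line_exists v : exists h : int -> V,
  [/\ h 0 = v, forall i, E (h i) (h (i + 1)) & forall i, h (i - 1) <> h (i + 1)].
Proof.
have nxt (xy : V * V) : exists z, E xy.1 xy.2 -> E xy.2 z /\ z <> xy.1.
  case: xy => x y /=; have [Exy|nE] := boolP (E x y); last by exists x.
  apply: contrapT => /forallNP no; apply: (@no_end_vertex y) => a b Ea Eb.
  have aux c : E y c -> c = x.
    by move=> Ec; apply: contrapT => cx; apply: (no c).
  by rewrite (aux a) // (aux b).
have [f fP] := choice nxt.
have [a [b [Ea Eb ab]]] : exists a b, [/\ E v a, E v b & a <> b].
  apply: contrapT => no; apply: (@no_end_vertex v) => a b Ea Eb.
  by apply: contrapT => ab; apply: no; exists a, b.
pose step (xy : V * V) := (xy.2, f xy).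
pose F p n := iter n step p.
have FE p n : E p.1 p.2 -> E (F p n).1 (F p n).2.
  by move=> pE; elim: n => [//|n IH] /=; have [] := fP _ IH.
have Fne p n : E p.1 p.2 -> (F p n.+2).1 <> (F p n).1.
  by move=> pE /=; have [] := fP _ (FE p n pE).
have va : E (v, a).1 (v, a).2 by [].
have vb : E (v, b).1 (v, b).2 by [].
(* [Negz n] stands for [-(n + 1)], hence the shifted index on the second ray. *)
exists (fun i => match i with Posz n => (F (v, b) n).1 | Negz n => (F (v, a) n.+1).1 end).
split => // -[n|n].
- by rewrite -PoszD addn1; apply: (FE (v, b)).
- case: n => [|n]; first exact: edge_sym.
  rewrite (_ : Negz n.+1 + 1 = Negz n); last by rewrite !NegzE; lia.
  by apply: edge_sym; apply: (FE (v, a)).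
- case: n => [|n].
    by rewrite (_ : 0%:Z - 1 = Negz 0) //= => /nesym; apply; apply: nesym.
  rewrite (_ : n.+1%:Z - 1 = n%:Z); last lia.
  rewrite (_ : n.+1%:Z + 1 = n.+2%:Z); last lia.
  by apply: nesym; apply: (Fne (v, b)).
- rewrite (_ : Negz n - 1 = Negz n.+1); last by rewrite !NegzE; lia.
  case: n => [|n]; first exact: (Fne (v, a)).
  rewrite (_ : Negz n.+1 + 1 = Negz n); last by rewrite !NegzE; lia.
  exact: (Fne (v, a)).
Qed.

(** The two-sided walk is injective because it never closes up, and surjective because its range is
    closed under adjacency. *)
Lemma line_isomorphic (v : V) : graph_isomorphic E Zpath.
Proof.
have [h [h0 hE hne]] := line_exists v.
have hE' i : E (h i) (h (i - 1)) by apply: edge_sym; have := hE (i - 1); rewrite subrK.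
have nbr i w : E (h i) w -> w = h (i - 1) \/ w = h (i + 1).
  exact: nbr2.
(* A shortest closed stretch would be a finite set closed under adjacency, hence the whole graph by
   connectedness, which is infinite. Minimality makes the two neighbours at the closing point
   distinct. *)
have noloop n : (0 < n)%N -> forall i : int, h i <> h (i + n%:Z).
  elim/ltn_ind: n => -[//|[|[|n]]] IH _ i e.
  - by have := hE i; rewrite -e simple.1.
  - apply: (hne (i + 1)); rewrite addrK e; congr h; lia.
  have ne : h (i + 1) <> h (i + n.+2%:Z).
    move=> e2; apply: (IH n.+1 _ _ (i + 1)) => //; rewrite e2; congr h; lia.
  apply: inf; apply: (@sub_finite_set _ _ [set h (i + k%:Z) | k in `I_n.+4]);
    last by apply: finite_image; apply: finite_II.
  move=> w _; apply: (@connected_ind (fun w => [set h (i + k%:Z) | k in `I_n.+4] w) (h i)).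
    by exists 0%N => //; rewrite addr0.
  have ends y : E (h i) y -> [set h (i + k%:Z) | k in `I_n.+4] y.
    have E2 : E (h i) (h (i + n.+2%:Z)).
      rewrite e; have := hE' (i + n.+3%:Z).
      by rewrite (_ : i + n.+3%:Z - 1 = i + n.+2%:Z) //; lia.
    case/(nbr2 (hE i) E2 ne) => ->; first by exists 1%N.
    by exists n.+2 => /=.
  move=> _ y [k /= kn <-] Ey.
  have [k0|k0] := posnP k; first by apply: ends; rewrite k0 addr0 in Ey.
  have [k3|k3] := eqVneq k n.+3; first by apply: ends; rewrite e -k3.
  case: (nbr _ _ Ey) => ->.
    by exists k.-1 => /=; [lia|congr h; lia].
  by exists k.+1 => /=; [lia|congr h; lia].
have hinj : injective h.
  move=> i j e; case: (ltrgtP i j) => // lt; exfalso.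
    apply: (@noloop `|j - i|%N _ i); [lia|rewrite e; congr h; lia].
  by apply: (@noloop `|i - j|%N _ j); [lia|rewrite -e; congr h; lia].
have hsurj w : exists i, h i = w.
  apply: (@connected_ind (fun w => exists i, h i = w) (h 0)); first by exists 0.
  by move=> _ y [i <-] /nbr[->|->]; [exists (i - 1)|exists (i + 1)].
have [f fK] := choice hsurj.
exists f; first by exists h => // i; apply: hinj; rewrite fK.
move=> u w; rewrite -[in RHS](fK u) -[in RHS](fK w); move: (f u) (f w) => i j.
rewrite /Zpath /=; apply/orP/idP => [[/eqP->|/eqP->]|/nbr[]/hinj->].
- exact: hE.
- exact: edge_sym.
- by right; rewrite subrK.
- by left.
Qed.

End NoBranching.
End QuasiTransitive.
End BoundedDegree.
End Walks.

(** * The line: dual weights *)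

Section Line.
Variable R : realType.
Implicit Types (eta xi : int -> R).

Local Ltac intlia :=
  repeat match goal with H : context [R] |- _ => clear H end; lia.

Lemma Zmove eta m : valid_move Zpath m -> exists x (mu : R),
  [/\ 0 < mu, mu <= 2^-1 & apply_move eta m = apply_move eta (Move x (x + 1) mu)].
Proof.
case: m => x y mu /andP[/= xy /andP[mu0 mu1]].
case/orP: xy => /eqP ->; first by exists x, mu.
exists y, mu; split => //; apply/funext => w /=.
case: eqP => [->|_]; last by [].
by rewrite (_ : (y + 1 == y) = false) //; lia.
Qed.

Definition unimodal (p : int) xi :=
  (forall x, x < p -> xi x <= xi (x + 1)) /\
  (forall x, p <= x -> xi (x + 1) <= xi x).

(** Since [mu <= 1/2], the endpoints approach each other without changing order. Only lowering the
    mode can break unimodality, and then the neighbour that has overtaken it is the new mode. *)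
Lemma unimodal_move p xi m : unimodal p xi -> valid_move Zpath m ->
  exists p', unimodal p' (apply_move xi m).
Proof.
move=> [up dn] /(Zmove xi)[x [mu [mu0 mu1 ->]]].
set z := apply_move _ _.
have zx : z x = xi x + mu * (xi (x + 1) - xi x) by rewrite /z /= eqxx.
have zx1 : z (x + 1) = xi (x + 1) + mu * (xi x - xi (x + 1)).
  by rewrite /z /= eqxx (_ : (x + 1 == x) = false) //; intlia.
have zo w : w != x -> w != x + 1 -> z w = xi w.
  by move=> wx wx1; rewrite /z /= (negbTE wx) (negbTE wx1).
have zm : z (x - 1) = xi (x - 1) by apply: zo; intlia.
have zp : z (x + 1 + 1) = xi (x + 1 + 1) by apply: zo; intlia.
have step w : [\/ w = x - 1, w = x, w = x + 1 | z w = xi w /\ z (w + 1) = xi (w + 1)].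
  have [->|w1] := eqVneq w (x - 1); first by constructor 1.
  have [->|w2] := eqVneq w x; first by constructor 2.
  have [->|w3] := eqVneq w (x + 1); first by constructor 3.
  by constructor 4; rewrite !zo //; intlia.
clearbody z.
case: (ltP x p) => xp.
  have ab := up _ xp.
  have ab1 : xi x <= z x by rewrite zx; nra.
  have ab2 : z x <= z (x + 1) by rewrite zx zx1; nra.
  have ab3 : z (x + 1) <= xi (x + 1) by rewrite zx1; nra.
  have up1 : xi (x - 1) <= xi x by have := up (x - 1); rewrite subrK; apply; intlia.
  have [xp1|xp1] := eqVneq (x + 1) p; last first.
    exists p; split => w wp; case: (step w) => [we|we|we|[e1 e2]]; subst.
    - by rewrite subrK zm; apply: le_trans ab1.
    - by [].
    - by rewrite zp; apply: le_trans ab3 _; apply: up.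
    - by rewrite e1 e2; apply: up.
    - by exfalso; intlia.
    - by exfalso; intlia.
    - by exfalso; intlia.
    - by rewrite e1 e2; apply: dn.
  have dp : xi (x + 1 + 1) <= xi (x + 1) by apply: dn; intlia.
  case: (lerP (z (x + 1)) (xi (x + 1 + 1))) => cmp.
    exists (p + 1); split => w wp; case: (step w) => [we|we|we|[e1 e2]]; subst.
    - by rewrite subrK zm; apply: le_trans ab1.
    - by [].
    - by rewrite zp.
    - rewrite e1 e2; have [wx|wx] := eqVneq w (x + 1); last by apply: up; intlia.
      by move: e1; rewrite wx; lra.
    - by exfalso; intlia.
    - by exfalso; intlia.
    - by exfalso; intlia.
    - by rewrite e1 e2; apply: dn; intlia.
  exists p; split => w wp; case: (step w) => [we|we|we|[e1 e2]]; subst.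
  - by rewrite subrK zm; apply: le_trans ab1.
  - by [].
  - by exfalso; intlia.
  - by rewrite e1 e2; apply: up.
  - by exfalso; intlia.
  - by exfalso; intlia.
  - by rewrite zp ltW.
  - by rewrite e1 e2; apply: dn.
have ab := dn _ xp.
have ab1 : z x <= xi x by rewrite zx; nra.
have ab2 : z (x + 1) <= z x by rewrite zx zx1; nra.
have ab3 : xi (x + 1) <= z (x + 1) by rewrite zx1; nra.
have dn1 : xi (x + 1 + 1) <= xi (x + 1) by apply: dn; intlia.
have [xp1|xp1] := eqVneq x p; last first.
  exists p; split => w wp; case: (step w) => [we|we|we|[e1 e2]]; subst.
  - by exfalso; intlia.
  - by exfalso; intlia.
  - by exfalso; intlia.
  - by rewrite e1 e2; apply: up.
  - rewrite subrK zm; apply: le_trans ab1 _.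
    by have := dn (x - 1); rewrite subrK; apply.
  - by [].
  - by rewrite zp; apply: le_trans ab3.
  - by rewrite e1 e2; apply: dn.
have up1 : xi (x - 1) <= xi x by have := up (x - 1); rewrite subrK; apply; intlia.
case: (lerP (z x) (xi (x - 1))) => cmp.
  exists (p - 1); split => w wp; case: (step w) => [we|we|we|[e1 e2]]; subst.
  - by exfalso; intlia.
  - by exfalso; intlia.
  - by exfalso; intlia.
  - by rewrite e1 e2; apply: up; intlia.
  - by rewrite subrK zm.
  - by [].
  - by rewrite zp; apply: le_trans ab3.
  - rewrite e1 e2; have [wx|wx] := eqVneq w (p - 1); last by apply: dn; intlia.
    by move: e2; rewrite wx subrK; lra.
exists p; split => w wp; case: (step w) => [we|we|we|[e1 e2]]; subst.
- by rewrite subrK zm ltW.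
- by exfalso; intlia.
- by exfalso; intlia.
- by rewrite e1 e2; apply: up.
- by exfalso; intlia.
- by [].
- by rewrite zp; apply: le_trans ab3.
- by rewrite e1 e2; apply: dn.
Qed.

Definition unit_mass (u : int) : R := (u == 0)%:R.

Lemma unimodal_moves ms : all (valid_move Zpath) ms ->
  exists p, unimodal p (apply_moves unit_mass ms).
Proof.
have : exists p, unimodal p unit_mass.
  exists 0; rewrite /unit_mass; split => x x0.
    by rewrite (_ : (x == 0) = false) ?ler0n //; lia.
  by rewrite (_ : (x + 1 == 0) = false) ?ler0n //; lia.
elim: ms unit_mass => [//|m ms IH] xi [p hp] /= /andP[vm vms].
by apply: IH vms; apply: unimodal_move hp vm.
Qed.

(* [F] is the cumulative mass; moving water across [(x, x + 1)] pulls [F x]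
   towards the mean of its neighbours, and the bound on [F y - F x] is
   concave in each variable. *)
Definition spread xi := exists F : int -> R,
  [/\ forall u, xi u = F u - F (u - 1), forall u, 0 <= F u <= 1 &
      forall x y : int, -1 <= x -> x <= y ->
        (y + 1)%:~R * (F y - F x) <= (y - x)%:~R].

Lemma spread_move xi m : spread xi -> valid_move Zpath m -> spread (apply_move xi m).
Proof.
move=> [F [xiF F01 Fxy]] /(Zmove xi)[z [mu [mu0 mu1 ->]]].
pose f := F z + mu * (F (z + 1) + F (z - 1) - 2 * F z).
have f01 : 0 <= f <= 1.
  have := F01 z; have := F01 (z + 1); have := F01 (z - 1); rewrite /f.
  by move=> /andP[? ?] /andP[? ?] /andP[? ?]; nra.
exists (fun w => if w == z then f else F w); split.
- move=> u /=; have [->|uz] := eqVneq u z.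
    by rewrite (_ : (z - 1 == z) = false) ?xiF /f ?addrK; [ring|lia].
  have [->|uz1] := eqVneq u (z + 1).
    by rewrite addrK eqxx !xiF addrK /f; ring.
  by rewrite (_ : (u - 1 == z) = false) //; lia.
- by move=> u; case: eqP.
move=> x y x1 xy.
have [xz|xz] := eqVneq x z.
  have [yz|yz] := eqVneq y z; first by rewrite subrr mulr0 ler0z; lia.
  have y0 : 0 <= (y + 1)%:~R :> R by rewrite ler0z; lia.
  (* Here [x - 1] is out of range, but at [x = -1] the bound only says that the difference is at
     most 1. *)
  have [xm|xm] := eqVneq x (-1).
    have -> : (y - x)%:~R = (y + 1)%:~R :> R by congr (_%:~R); lia.
    by have /andP[? ?] := F01 y; case/andP: f01 => ? ?; nra.
  (* The bound is affine in [x]: the cases [x], [x + 1], [x - 1] combine with weights [1 - 2 mu],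
     [mu], [mu]. *)
  have h0 := Fxy x y x1 xy.
  have h1 := Fxy (x + 1) y (ltac:(lia)) (ltac:(lia)).
  have h2 := Fxy (x - 1) y (ltac:(lia)) (ltac:(lia)).
  move: h0 h1 h2; rewrite {x1 xy xm}xz /f.
  have -> : (y - (z + 1))%:~R = (y - z)%:~R - 1 :> R by rewrite !(intrB, intrD) mulr1z; ring.
  have -> : (y - (z - 1))%:~R = (y - z)%:~R + 1 :> R by rewrite !(intrB, intrD) mulr1z; ring.
  move: (F y) (F z) (F (z + 1)) (F (z - 1)) ((y + 1)%:~R : R) ((y - z)%:~R : R) y0.
  by move=> A B C D Y S y0 h0 h1 h2; nra.
have [yz|yz] := eqVneq y z; last exact: Fxy.
have [xm|xm] := eqVneq x (-1).
  have -> : (y - x)%:~R = (y + 1)%:~R :> R by congr (_%:~R); lia.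
  have y0 : 0 <= (y + 1)%:~R :> R by rewrite ler0z; lia.
  by have /andP[? ?] := F01 x; case/andP: f01 => ? ?; nra.
have h0 := Fxy x y x1 xy.
have h1 := Fxy x (y + 1) (ltac:(lia)) (ltac:(lia)).
have h2 := Fxy x (y - 1) (ltac:(lia)) (ltac:(lia)).
have t1 : 1 <= (x + 1)%:~R :> R by rewrite ler1z; lia.
have t2 : (x + 1)%:~R <= y%:~R :> R by rewrite ler_int; lia.
move: h0 h1 h2 t1 t2; rewrite /f -yz !(intrB, intrD) !mulr1z.
move: (F y) (F x) (F (y + 1)) (F (y - 1)) (x%:~R : R) (y%:~R : R).
move=> A B C D X Y h0 h1 h2 t1 t2.
have Y0 : 0 < Y by lra.
have e0 : A - B <= 1 - (X + 1) / (Y + 1).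
  rewrite -subr_ge0 (_ : _ - _ = ((Y - X) - (Y + 1) * (A - B)) / (Y + 1)).
    by rewrite divr_ge0; lra.
  by field; lra.
have e1 : C - B <= 1 - (X + 1) / (Y + 2).
  rewrite -subr_ge0
    (_ : _ - _ = ((Y + 1 - X) - (Y + 1 + 1) * (C - B)) / (Y + 2)).
    by rewrite divr_ge0; lra.
  by field; lra.
have e2 : D - B <= 1 - (X + 1) / Y.
  rewrite -subr_ge0
    (_ : _ - _ = ((Y - 1 - X) - (Y - 1 + 1) * (D - B)) / Y).
    by rewrite divr_ge0; lra.
  by field; lra.
(* Convexity of [1 / (Y + 1)] in [Y], which is the concavity of the bound in [y]. *)
have conv : 2 * ((X + 1) / (Y + 1)) <= (X + 1) / (Y + 2) + (X + 1) / Y.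
  rewrite -subr_ge0 (_ : _ - _ = (X + 1) * 2 / ((Y + 1) * (Y + 2) * Y)).
    by rewrite divr_ge0 // !mulr_ge0; lra.
  by field; lra.
have h : A + mu * (C + D - 2 * A) - B <= 1 - (X + 1) / (Y + 1) by nra.
have Y1 : 0 < Y + 1 by lra.
apply: le_trans (ler_wpM2l (ltW Y1) h) _.
by rewrite mulrBr mulr1 [_ * (_ / _)]mulrC divfK ?gt_eqF //; lra.
Qed.

Lemma spread_moves ms : all (valid_move Zpath) ms ->
  spread (apply_moves unit_mass ms).
Proof.
have : spread unit_mass.
  exists (fun u : int => (0 <= u)%R%:R); split => [u|u|x y x1 xy].
  - rewrite /unit_mass; case: (ltgtP u 0) => u0.
    + by rewrite (_ : (0 <= u - 1) = false) ?subr0 //; lia.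
    + by rewrite (_ : (0 <= u - 1)) ?subrr //; lia.
    + by rewrite u0 /= subr0.
  - by case: (0 <= u); rewrite ?ler01 ?lexx.
  - have [x0|x0] := leP 0 x.
      by rewrite (_ : 0 <= y) ?subrr ?mulr0 ?ler0z; lia.
    rewrite subr0; case: (leP 0 y) => y0; last by rewrite mulr0 ler0z; lia.
    by rewrite mulr1 ler_int; lia.
elim: ms unit_mass => [//|m ms IH] xi h /= /andP[vm vms].
by apply: IH vms; apply: spread_move h vm.
Qed.

(** The spread bound at the adjacent indices [m - 1] and [m]. *)
Lemma height_ge0 ms (m : int) : 0 <= m -> all (valid_move Zpath) ms ->
  (m + 1)%:~R * apply_moves unit_mass ms m <= 1.
Proof.
move=> m0 /spread_moves[F [-> _ h]].
have := h (m - 1) m (ltac:(lia)) (ltac:(lia)).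
by rewrite (_ : m - (m - 1) = 1) //; lia.
Qed.

Lemma height ms (m : int) : all (valid_move Zpath) ms ->
  `|m|%N.+1%:R * apply_moves unit_mass ms m <= 1.
Proof.
move=> vms; case: (leP 0 m) => m0.
  by have := height_ge0 m0 vms;
    rewrite (_ : m + 1 = `|m|%N.+1%:Z) -?pmulrn //; intlia.
(* Reflection about 0 reduces negative [m] to the case already treated. *)
pose ms' := [seq Move (- move_src m) (- move_dst m) (move_mu m) | m <- ms].
have vms' : all (valid_move Zpath) ms'.
  rewrite all_map; apply: sub_all vms => -[x y mu] /=.
  rewrite /valid_move /= => /andP[xy ->]; rewrite andbT.
  by case/orP: xy => /eqP ->; apply/orP; [right|left]; apply/eqP; ring.
have := @height_ge0 ms' (- m) (ltac:(lia)) vms'.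
have -> : apply_moves unit_mass ms' (- m) = apply_moves unit_mass ms m.
  rewrite (apply_moves_iso (h := -%R)); last by exists -%R; exact: opprK.
  by congr apply_moves; apply/funext => u; rewrite /unit_mass /= oppr_eq0.
by rewrite (_ : - m + 1 = `|m|%N.+1%:Z) -?pmulrn //; intlia.
Qed.

Lemma seq_int_bounded (l : seq int) (p : int) :
  exists n, {in l, forall u, (`|u - p| < n)%N}.
Proof.
elim: l => [|x l [n IH]]; first by exists 0%N.
exists (maxn n `|x - p|.+1) => u; rewrite inE leq_max.
by case/orP => [/eqP ->|/IH ->]; rewrite ?leqnn ?orbT.
Qed.

(** By duality the level at 0 is a weighting of [eta] that is unimodal about some [p], with height
    at most [1 / (|p| + 1)]. Abel summation of [eta - lam] on each side of [p] costs at most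
    [(1 - lam) / M]. *)
Lemma line_upper eta (lam : R) (M : nat) ms : (0 < M)%N -> lam <= 1 ->
  (forall u, eta u <= 1) ->
  (forall (p : int) (k : nat), (`|p|.+1 <= k * M)%N ->
     \sum_(j < k) eta (p + j%:Z) <= lam * k%:R /\
     \sum_(j < k) eta (p - 1 - j%:Z) <= lam * k%:R) ->
  all (valid_move Zpath) ms ->
  apply_moves eta ms 0 <= lam + 2 * (1 - lam) / M%:R.
Proof.
move=> M0 lam1 eta1 avg vms.
have vrms : all (valid_move Zpath) (rev ms) by rewrite all_rev.
have [p [up dn]] := unimodal_moves vrms.
have hp := height p vrms.
set xi := apply_moves unit_mass (rev ms) in up dn hp.
have xi0 u : 0 <= xi u.
  by apply: apply_moves_ge vrms _ => w; rewrite ler0n.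
have [n nP] := seq_int_bounded
  (0 :: map (@move_src R int) ms ++ map (@move_dst R int) ms) p.
(* A finite interval around [p] that contains 0 and every vertex touched by a move. *)
pose s := [seq p + j%:Z | j <- iota 0 n] ++ [seq p - 1 - j%:Z | j <- iota 0 n].
have sP u : (`|u - p| < n)%N -> u \in s.
  move=> un; rewrite mem_cat; apply/orP; case: (leP p u) => pu; [left|right].
    by apply/mapP; exists `|u - p|%N; [rewrite mem_iota|]; intlia.
  by apply/mapP; exists `|(p - 1 - u)%R|%N; [rewrite mem_iota|]; intlia.
have us : uniq s.
  rewrite cat_uniq !map_inj_uniq ?iota_uniq /=; first last.
  - by move=> i j; intlia.
  - by move=> i j; intlia.
  rewrite andbT; apply/hasPn => _ /mapP[j _ ->]; apply/negP => /mapP[i _]; intlia.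
have dual eta' : apply_moves eta' ms 0 = \sum_(u <- s) xi u * eta' u.
  rewrite /xi apply_moves_adjoint //; last first.
    rewrite -[ms]map_id all_map.
    have {}nP : {in map (@move_src R int) ms ++ map (@move_dst R int) ms, forall u, u \in s}.
      by move=> u ul; apply: sP; apply: nP; rewrite inE ul orbT.
    have /allP := nP; rewrite all_cat !all_map => /andP[h1 h2].
    rewrite (eq_all (a2 := predI (fun m => move_src m \in s)
      (fun m => move_dst m \in s))) //.
    by rewrite all_predI h1.
  rewrite -[LHS](sum_pick (apply_moves eta' ms) us) //.
  by apply: sP; apply: nP; rewrite inE eqxx.
(* Moves fix constant profiles, so the weights have total mass one and [lam] can be split off. *)
have -> : apply_moves eta ms 0 = lam + \sum_(u <- s) xi u * (eta u - lam).
  have := dual (fun=> lam); rewrite apply_moves_cst => {1}->.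
  by rewrite -big_split dual; apply: eq_bigr => u _ /=; ring.
rewrite lerD2l /s big_cat !big_map /=.
have iotaE (f : nat -> R) : \sum_(j <- iota 0 n) f j = \sum_(j < n) f j.
  by rewrite -[n in iota 0 n]subn0 -/(index_iota 0 n) big_mkord.
rewrite !iotaE.
pose P : R := `|p|%N.+1%:R; have P0 : 0 < P by rewrite ltr0n.
have MR : 0 < M%:R :> R by rewrite ltr0n.
(* [B] bounds all partial sums of [eta - lam] from [p] outwards: long ones are nonpositive by
   hypothesis, and a short one has fewer than [P / M] terms, each at most [1 - lam]. *)
set B := P * (1 - lam) / M%:R.
have B0 : 0 <= B by rewrite divr_ge0 ?mulr_ge0 ?subr_ge0 // ltW.
have part (f : nat -> int) k : ((`|p|.+1 <= k * M)%N -> \sum_(j < k) eta (f j) <= lam * k%:R) ->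
    \sum_(j < k) (eta (f j) - lam) <= B.
  move=> h; case: (leqP `|p|%N.+1 (k * M)) => kM.
    apply: le_trans B0; rewrite sumrB sumr_const card_ord subr_le0.
    by apply: le_trans (h kM) _; rewrite mulr_natr.
  apply: (@le_trans _ _ (\sum_(j < k) (1 - lam))).
    by apply: ler_sum => i _; rewrite lerD2r.
  rewrite sumr_const card_ord -mulr_natl /B mulrAC ler_wpM2r ?subr_ge0 //.
  by rewrite ler_pdivlMr // -natrM /P ler_nat ltnW.
have xiB y : xi y <= xi p -> xi y * B <= (1 - lam) / M%:R.
  move=> yp; apply: (@le_trans _ _ (xi p * B)); first by rewrite ler_wpM2r.
  have -> : xi p * B = P * xi p * ((1 - lam) / M%:R) by rewrite /B; ring.
  by rewrite -[leRHS]mul1r ler_wpM2r ?divr_ge0 ?subr_ge0 ?ler0n.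
have right : \sum_(j < n) xi (p + j%:Z) * (eta (p + j%:Z) - lam) <= xi p * B.
  apply: le_trans (abel_le (a := fun j => xi (p + j%:Z))
    (c := fun j => eta (p + j%:Z) - lam) n B0 _ _ _) _ => //; last by rewrite addr0.
    by move=> j; have := dn (p + j%:Z) (ltac:(intlia));
      rewrite (_ : p + j%:Z + 1 = p + j.+1%:Z) //; intlia.
  by move=> k; apply: (part (fun j => p + j%:Z)) => kM; case: (avg p k kM).
have left : \sum_(j < n) xi (p - 1 - j%:Z) * (eta (p - 1 - j%:Z) - lam) <= xi (p - 1) * B.
  apply: le_trans (abel_le (a := fun j => xi (p - 1 - j%:Z))
    (c := fun j => eta (p - 1 - j%:Z) - lam) n B0 _ _ _) _ => //; last by rewrite subr0.
    by move=> j; have := up (p - 1 - j.+1%:Z) (ltac:(intlia));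
      rewrite (_ : p - 1 - j.+1%:Z + 1 = p - 1 - j%:Z) //; intlia.
  by move=> k; apply: (part (fun j => p - 1 - j%:Z)) => kM; case: (avg p k kM).
have xip : xi (p - 1) <= xi p by have := up (p - 1) (ltac:(intlia)); rewrite subrK.
have := xiB p (lexx _); have := xiB (p - 1) xip; lra.
Qed.

(** For large [n] the first average is typically close to 1/2, so that a level above 1/2 at [m]
    lifts [kappa] above 1/2. *)
Lemma line_lower eta (m n : nat) : (forall u, 0 <= eta u <= 1) -> (0 < m)%N ->
  (m%:R * ((\sum_(j < m + n) eta (m%:Z - 1 - j%:Z)) / (m + n)%:R) + eta m%:Z)
    / m.+1%:R <= kappa Zpath eta 0.
Proof.
move=> eta01 m0; pose q1 (j : nat) := m%:Z - 1 - j%:Z; pose q2 (j : nat) := j%:Z.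
set A := _ / (m + n)%:R.
(* First the [m + n] vertices from [m - 1] down to [- n] are averaged; [m] is left untouched. *)
have r1 : reach Zpath eta (flat q1 (m + n).-1 A eta).
  have := @reach_path_average R _ Zpath q1 (m + n).-1 eta; rewrite prednK ?ltn_addr //.
  apply; first by move=> i _; rewrite /q1 /=; apply/orP; right; apply/eqP; intlia.
  by move=> i j _ _; rewrite /q1; intlia.
set z1 := flat _ _ _ _ in r1.
(* Then [[0, m]] is averaged: its first [m] vertices carry [A], the last one [eta m]. *)
have r2 : reach Zpath z1 (flat q2 m ((\sum_(i < m.+1) z1 (q2 i)) / m.+1%:R) z1).
  apply: reach_path_average; last by move=> i j _ _ [].
  by move=> i _; rewrite /q2 /=; apply/orP; left; apply/eqP; intlia.
have := kappa_ge_reach (q2 0%N) eta01 (reach_trans r1 r2).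
rewrite flat_in // => h; apply: le_trans _ h.
rewrite le_eqVlt; apply/orP; left; apply/eqP; congr (_ / _).
rewrite big_ord_recr /=; congr (_ + _).
  rewrite (eq_bigr (fun=> A)) => [|i _]; first by rewrite sumr_const card_ord mulr_natl.
  have -> : q2 i = q1 (m - 1 - i)%N by rewrite /q1 /q2; have := ltn_ord i; intlia.
  by rewrite /z1 flat_in //; intlia.
rewrite /z1 /flat; case: ifP => // /mapP[i]; rewrite mem_iota /q1 /q2; intlia.
Qed.

End Line.

(** * Independent uniform levels *)

Section Subadditivity.
Context d (T : measurableType d) (R : realType) (P : probability T R).

Lemma measure_le_sum (I : choiceType) (s : seq I) (F : I -> set T) (B : set T) :
  (forall i, measurable (F i)) -> measurable B ->
  (forall t, B t -> exists2 i, i \in s & F i t) ->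
  (P B <= \sum_(i <- s) P (F i))%E.
Proof.
move=> mF mB Bs.
have mU (r : seq I) : measurable (\big[setU/set0]_(i <- r) F i).
  exact: bigsetU_measurable.
apply: (@le_trans _ _ (P (\big[setU/set0]_(i <- s) F i))).
  apply: le_measure; rewrite ?inE // -bigcup_seq => t /Bs[i si Fi].
  by exists i.
elim: s {Bs} => [|i s IH]; first by rewrite !big_nil measure0.
rewrite !big_cons; apply: (le_trans (measureU2 _ _ _)) => //.
exact: leeD2l.
Qed.

Lemma measure_le_series (F : nat -> set T) (B : set T) (c : nat -> R) (th : R) :
  (forall n, measurable (F n)) -> measurable B -> B `<=` \bigcup_n F n ->
  (forall n, (P (F n) <= (c n)%:E)%E) ->
  (forall n, \sum_(i < n) c i <= th) -> (P B <= th%:E)%E.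
Proof.
move=> mF mB Bs Pc cth.
apply: le_trans (measure_sigma_subadditive P mF mB Bs) _.
apply: lime_le; first exact: is_cvg_nneseries.
near=> n; rewrite big_mkord; apply: (@le_trans _ _ (\sum_(i < n) (c i)%:E)%E).
  by apply: lee_sum => i _; exact: Pc.
by rewrite sumEFin lee_fin.
Unshelve. all: by end_near. Qed.

End Subadditivity.

(** * Rectangles and a Markov inequality for independent coordinates *)

Section IndependentProducts.
Context d (T : measurableType d) (R : realType) (P : probability T R).
Variables (I : choiceType) (X : I -> {RV P >-> R}).
Hypothesis indep : mutually_independent X.

(** Carrying a rectangle as a factor through the bounds below replaces conditioning on finitely many
    other coordinates. *)
Definition rect (s : seq I) (A : I -> set R) : set T :=
  \bigcap_(i in [set` s]) (X i @^-1` A i).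

Definition rect_prob (s : seq I) (A : I -> set R) : R :=
  \prod_(i <- s) fine (P (X i @^-1` A i)).

Lemma measurable_preim i (A : set R) : measurable A -> measurable (X i @^-1` A).
Proof. by move=> mA; rewrite -[_ @^-1` _]setTI; exact: measurable_funP. Qed.

Lemma rectE s A : uniq s -> (forall i, measurable (A i)) ->
  P (rect s A) = (rect_prob s A)%:E.
Proof.
move=> us mA; rewrite /rect indep // /rect_prob.
elim: s {us} => [|i s IH]; first by rewrite !big_nil.
rewrite !big_cons IH EFinM fineK // fin_num_measure //.
exact: measurable_preim.
Qed.

Lemma rect_prob_ge0 s A : 0 <= rect_prob s A.
Proof. by apply: prodr_ge0 => i _; apply: fine_ge0. Qed.

Lemma measurable_rect s A : (forall i, measurable (A i)) -> measurable (rect s A).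
Proof.
move=> mA; rewrite /rect bigcap_seq; apply: bigsetI_measurable => i _.
exact: measurable_preim.
Qed.

Variables (K : finType) (cell : R -> K) (p : K -> R).
Hypothesis mcell : forall k, measurable (cell @^-1` [set k]).
Hypothesis pcell : forall i k, (P (X i @^-1` (cell @^-1` [set k])) <= (p k)%:E)%E.

(* Markov's inequality for a product of independent factors, on a rectangle of
   other coordinates; conditioning on one cell at a time turns each step of
   the induction into one of the same shape. *)
Lemma markov_prod (J : eqType) (u : J -> I) (w : J -> K -> R) (a b : R)
    (st : seq J) (s0 : seq I) (A : I -> set R) (B : set T) :
  (forall j k, 0 <= w j k) -> 0 < a -> 0 <= b ->
  uniq (map u st ++ s0) -> (forall i, measurable (A i)) -> measurable B ->
  (forall t, B t -> rect s0 A t /\ a <= b * \prod_(j <- st) w j (cell (X (u j) t))) ->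
  (P B <= (rect_prob s0 A * (b * \prod_(j <- st) \sum_k p k * w j k) / a)%:E)%E.
Proof.
move=> w0 a0; elim: st s0 A b B => [|j st IH] s0 A b B b0 /= us mA mB hB.
  rewrite big_nil mulr1; have [ab|ba] := leP a b; last first.
    rewrite (_ : B = set0) ?measure0 ?lee_fin ?divr_ge0 ?mulr_ge0 ?rect_prob_ge0 ?(ltW a0) //.
    by apply/seteqP; split => // t /hB[_]; rewrite big_nil mulr1 leNgt ba.
  apply: (@le_trans _ _ (rect_prob s0 A)%:E).
    rewrite -rectE //; apply: le_measure; rewrite ?inE //; first exact: measurable_rect.
    by move=> t /hB[].
  by rewrite lee_fin -mulrA ler_peMr ?rect_prob_ge0 // ler_pdivlMr // mul1r.
have p0 k : 0 <= p k.
  by rewrite -lee_fin; apply: le_trans (pcell (u j) k).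
set v := u j in us hB *.
(* On the slice [k] the factor of [j] is the constant [w j k], which joins [b], while the coordinate
   [v] joins the rectangle. *)
pose Bk k := B `&` X v @^-1` (cell @^-1` [set k]).
have mBk k : measurable (Bk k) by apply: measurableI => //; apply: measurable_preim.
have {}us : uniq (map u st ++ v :: s0).
  by rewrite -[v :: s0]cat1s uniq_catCA.
have /andP[v_s0 _] : uniq (v :: s0) by move: us; rewrite cat_uniq => /and3P[].
pose A' k i := if i == v then cell @^-1` [set k] else A i.
have mA' k i : measurable (A' k i) by rewrite /A'; case: eqP.
have step k : (P (Bk k) <=
    (rect_prob s0 A * (b * \prod_(i <- st) \sum_k p k * w i k) / a * (p k * w j k))%:E)%E.
  have h : (P (Bk k) <= (rect_prob (v :: s0) (A' k) *
      ((b * w j k) * \prod_(i <- st) \sum_k p k * w i k) / a)%:E)%E.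
    apply: IH => //; first exact: mulr_ge0.
    move=> t [Bt ck]; have [rt le] := hB t Bt; split.
      move=> i /=; rewrite inE /A'; have [->//|_ /= is0] := eqVneq i v.
      exact: rt.
    by move: le; rewrite big_cons ck mulrA.
  apply: le_trans h _; rewrite lee_fin /rect_prob big_cons.
  rewrite (eq_big_seq (fun i => fine (P (X i @^-1` A i)))); last first.
    move=> i is0; rewrite /A'; case: eqP => // e.
    by rewrite e (negbTE v_s0) in is0.
  rewrite -/(rect_prob s0 A) /A' eqxx.
  set q := fine _; have qp : q <= p k.
    rewrite -lee_fin fineK; first exact: pcell.
    by apply: fin_num_measure; apply: measurable_preim.
  set Q := rect_prob s0 A; set Y := \prod_(i <- st) _.
  have Q0 : 0 <= Q := rect_prob_ge0 s0 A.
  have Y0 : 0 <= Y by apply: prodr_ge0 => i _; apply: sumr_ge0 => l _; apply: mulr_ge0.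
  have -> : q * Q * (b * w j k * Y) / a = q * (Q * (b * w j k * Y) / a) by ring.
  have -> : Q * (b * Y) / a * (p k * w j k) = p k * (Q * (b * w j k * Y) / a) by ring.
  by rewrite ler_wpM2r // divr_ge0 ?(ltW a0) // !mulr_ge0.
apply: (@le_trans _ _ (\sum_(k <- enum K) P (Bk k))%E).
  apply: measure_le_sum => // t Bt; exists (cell (X v t)) => //.
  by rewrite mem_enum.
rewrite big_enum /=; apply: le_trans (lee_sum _ (fun k _ => step k)) _.
rewrite sumEFin lee_fin -mulr_sumr big_cons; set S := \sum_k _.
by rewrite le_eqVlt; apply/orP; left; apply/eqP; ring.
Qed.

End IndependentProducts.

Section UniformLevels.
Context d (T : measurableType d) (R : realType) (P : probability T R).
Local Notation mu := lebesgue_measure.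

Lemma uniform01E (X : {RV P >-> R}) (A : set R) : uniform01 X -> measurable A ->
  P (X @^-1` A) = mu (A `&` `[0, 1]).
Proof.
move=> uX mA; have := uX A mA; rewrite /distribution /pushforward => ->.
rewrite /uniform_prob integral_uniform_pdf.
rewrite (eq_integral (cst 1%E)); last first.
  by move=> x; rewrite inE => -[_] /=; rewrite in_itv /= /uniform_pdf => ->; rewrite subr0 invr1.
by rewrite integral_cst ?mul1e //; apply: measurableI.
Qed.

Lemma uniform01_le (X : {RV P >-> R}) (A : set R) (a b : R) :
  uniform01 X -> measurable A -> a <= b ->
  A `&` `[0, 1] `<=` `[a, b] -> (P (X @^-1` A) <= (b - a)%:E)%E.
Proof.
move=> uX mA ab sub; rewrite uniform01E //.
apply: (@le_trans _ _ (mu (`[a, b]%classic : set R))).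
  by apply: le_measure; rewrite ?inE //; apply: measurableI.
rewrite lebesgue_measure_itv /= lte_fin; case: ifP => _ //.
by rewrite lee_fin subr_ge0.
Qed.

Lemma uniform01_ge (X : {RV P >-> R}) (A : set R) (a b : R) :
  uniform01 X -> measurable A -> 0 <= a -> a <= b -> b <= 1 ->
  `[a, b] `<=` A -> ((b - a)%:E <= P (X @^-1` A))%E.
Proof.
move=> uX mA a0 ab b1 sub; rewrite uniform01E //.
apply: (@le_trans _ _ (mu (`[a, b]%classic : set R))).
  rewrite lebesgue_measure_itv /= lte_fin; case: ifP => // /negbT.
  by rewrite -leNgt => ba; rewrite lee_fin subr_le0.
apply: le_measure; rewrite ?inE //; first exact: measurableI.
move=> x abx; split; first exact: sub.
by move: abx; rewrite /= !in_itv /= => /andP[? ?]; apply/andP; split; lra.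
Qed.

Section Grid.
Variable n : nat.

(** The minimum puts [x = 1] into the last cell and keeps the map monotone on the whole real line,
    so that all cells are intervals. *)
Definition grid_cell (x : R) : 'I_n.+1 := inord (minn (Num.truncn (n.+1%:R * x)) n).

Lemma grid_cell_mono x y : x <= y -> (grid_cell x <= grid_cell y)%N.
Proof.
move=> xy; rewrite /grid_cell !inordK ?ltnS ?geq_minr //.
have le : (Num.truncn (n.+1%:R * x) <= Num.truncn (n.+1%:R * y))%N.
  by apply: le_truncn; rewrite ler_wpM2l.
by rewrite leq_min geq_minr andbT (leq_trans (geq_minl _ _)).
Qed.

Lemma measurable_grid_cell k : measurable (grid_cell @^-1` [set k]).
Proof.
apply: is_interval_measurable => x y /= xk yk z /andP[xz zy].
apply/val_inj/eqP; rewrite eqn_leq -{1}yk -xk.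
by rewrite !grid_cell_mono.
Qed.

Lemma grid_cell_itv x : 0 <= x <= 1 ->
  (grid_cell x)%:R / n.+1%:R <= x <= (grid_cell x).+1%:R / n.+1%:R.
Proof.
move=> /andP[x0 x1]; rewrite /grid_cell inordK ?ltnS ?geq_minr //.
have n0 : 0 < n.+1%:R :> R by rewrite ltr0n.
have xn : 0 <= n.+1%:R * x by rewrite mulr_ge0.
have /andP[t1 t2] := truncn_itv xn.
rewrite ler_pdivrMr // ler_pdivlMr // [x * _]mulrC.
case: (leqP (Num.truncn (n.+1%:R * x)) n) => h.
  by rewrite t1 ltW.
apply/andP; split; last by rewrite -[leRHS]mulr1 ler_wpM2l.
by apply: le_trans t1; rewrite ler_nat ltnW.
Qed.

Lemma grid_cell_prob (X : {RV P >-> R}) k : uniform01 X ->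
  (P (X @^-1` (grid_cell @^-1` [set k])) <= (n.+1%:R^-1)%:E)%E.
Proof.
move=> uX; have n0 : 0 < n.+1%:R :> R by rewrite ltr0n.
rewrite (_ : n.+1%:R^-1 = k.+1%:R / n.+1%:R - k%:R / n.+1%:R :> R); last first.
  by rewrite -mulrBl -natrB // subSnn mul1r.
apply: uniform01_le => //; first exact: measurable_grid_cell.
  by rewrite ler_wpM2r ?invr_ge0 ?(ltW n0) // ler_nat.
move=> x [/= xk]; rewrite !in_itv /= => x01.
by have := grid_cell_itv x01; rewrite xk.
Qed.

End Grid.

(** * Exponential tail bounds *)

Section Chernoff.
Variables (I : choiceType) (X : I -> {RV P >-> R}).
Hypothesis indep : mutually_independent X.
Hypothesis unif : forall i, uniform01 (X i).

(** The boolean selects the tail: [true] for sums above the mean, [false] for sums below it. *)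
Definition centered (b : bool) (x : R) : R := if b then x - 2^-1 else 2^-1 - x.

(** A discretised moment generating function. In the quadratic expansion the second-order term gives
    at most [t ^+ 2 / 2], and so does the mean of [t * y], because [1 / (n + 1) <= t]. *)
Lemma grid_moment (n : nat) (t : R) (y : 'I_n.+1 -> R) :
  0 <= t -> t <= 1 -> n.+1%:R^-1 <= t -> (forall k, `|y k| <= 2^-1) ->
  \sum_k y k <= 2^-1 ->
  \sum_k n.+1%:R^-1 * expR (t * y k) <= expR (t ^+ 2).
Proof.
move=> t0 t1 nt y1 ysum; apply: le_trans (expR_ge1Dx _).
have n0 : 0 < n.+1%:R :> R by rewrite ltr0n.
have n1 : 0 <= n.+1%:R^-1 :> R by rewrite invr_ge0 ltW.
apply: (@le_trans _ _ (\sum_k n.+1%:R^-1 * (1 + t * y k + t ^+ 2 / 2))).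
  apply: ler_sum => k _; rewrite ler_wpM2l //.
  have := y1 k; have := expR_le_quad (y := t * y k).
  rewrite normrM (ger0_norm t0) => h yk.
  have yk2 : y k ^+ 2 <= 4^-1.
    by move: yk; rewrite ler_norml => /andP[? ?]; nra.
  apply: le_trans (h _) _; first by apply: (@le_trans _ _ (1 * 2^-1)); [exact: ler_pM|lra].
  rewrite exprMn lerD2l mulrCA; have := sqr_ge0 t; nra.
rewrite -mulr_sumr !big_split /= sumr_const card_ord -mulr_sumr sumr_const card_ord.
rewrite -[t ^+ 2 / 2 *+ _]mulr_natr -[1 *+ _]/(n.+1%:R).
rewrite !mulrDr mulVf ?gt_eqF // [X in _ + X](_ : _ = t ^+ 2 / 2); last first.
  by rewrite mulrCA mulVf ?mulr1 // gt_eqF.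
set s := \sum_k _ in ysum *.
have : n.+1%:R^-1 * (t * s) <= t * (t * 2^-1).
  by apply: (@le_trans _ _ (n.+1%:R^-1 * (t * 2^-1))); rewrite ?ler_wpM2l ?ler_wpM2r ?mulr_ge0 ?invr_ge0.
by move: (_ * (t * s)) => z; rewrite expr2; nra.
Qed.

(** Chernoff's bound. It is stated with two equal powers: in the union bound over windows one pays
    for their number, the other is summed over their length. [J] may be shorter than [l], since
    vertices near 0 will be dropped. *)
Lemma uniform_sum_tail (e : R) : 0 < e <= 1 -> exists2 r : R, 0 < r < 1 &
  forall (b : bool) (J s0 : seq I) (A : I -> set R) (l : nat) (B : set T),
    uniq (J ++ s0) -> (size J <= l)%N -> (forall i, measurable (A i)) ->
    measurable B ->
    (forall t, B t -> [/\ rect X s0 A t, forall i, 0 <= X i t <= 1 &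
       e * l%:R <= \sum_(i <- J) centered b (X i t)]) ->
    (P B <= (rect_prob X s0 A * (r ^+ l * r ^+ l))%:E)%E.
Proof.
(* [r] takes half of the Chernoff exponent [t ^+ 2 - t * e], which is negative for this [t]. *)
move=> /andP[e0 e1]; pose t := e / 4; pose r := expR ((t ^+ 2 - t * e) / 2).
have t0 : 0 < t by rewrite /t; lra.
exists r.
  rewrite expR_gt0 expR_lt1 /=.
  have : t * t < t * e by rewrite ltr_pM2l // /t; lra.
  by rewrite expr2; lra.
move=> b J s0 A l B us Jl mA mB hB.
pose n := Num.truncn t^-1.
have nt : n.+1%:R^-1 <= t.
  by rewrite -[leRHS]invrK lef_pV2 ?posrE ?ltr0n ?invr_gt0 // ltW // truncnS_gt.
have n0 : 0 < n.+1%:R :> R by rewrite ltr0n.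
(* The value of [centered b] at the unfavourable end of the cell, hence an upper bound on the whole
   cell. *)
pose y (k : 'I_n.+1) : R :=
  if b then k.+1%:R / n.+1%:R - 2^-1 else 2^-1 - k%:R / n.+1%:R.
have y_abs k : `|y k| <= 2^-1.
  have k0 : (0 : R) <= k%:R by [].
  have k1 : k.+1%:R / n.+1%:R <= 1 :> R by rewrite ler_pdivrMr // mul1r ler_nat.
  have k2 : k%:R / n.+1%:R <= k.+1%:R / n.+1%:R :> R.
    by rewrite ler_wpM2r ?invr_ge0 ?(ltW n0) // ler_nat.
  have k3 : 0 <= k%:R / n.+1%:R :> R by rewrite divr_ge0 // ltW.
  rewrite ler_norml /y; move: (k%:R / n.+1%:R) (k.+1%:R / n.+1%:R) k1 k2 k3.
  by move=> f g k1 k2 k3; case: (b); apply/andP; split; lra.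
have sumk : \sum_(k < n.+1) (k%:R : R) = n.+1%:R * n%:R / 2.
  elim: (n) => [|m IHm]; first by rewrite big_ord1 mulr0 mul0r.
  by rewrite big_ord_recr /= IHm -!natr1; field.
have y_sum : \sum_k y k <= 2^-1.
  rewrite /y; case: b {hB y y_abs}.
    rewrite sumrB -mulr_suml sumr_const card_ord -mulr_natr.
    rewrite (eq_bigr (fun k : 'I_n.+1 => k%:R + 1)) => [|k _]; last by rewrite natr1.
    rewrite big_split /= sumk sumr_const card_ord -[1 *+ _]/(n.+1%:R).
    rewrite -natr1 le_eqVlt; apply/orP; left; apply/eqP; by field.
  rewrite sumrB -mulr_suml sumr_const card_ord -mulr_natr sumk.
  rewrite -natr1 le_eqVlt; apply/orP; left; apply/eqP; by field.
have y_dom x : 0 <= x <= 1 -> centered b x <= y (grid_cell n x).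
  move=> x01; have /andP[] := grid_cell_itv n x01; rewrite /centered /y.
  by move: (_ / _) (_ / _) => f g ? ?; case: (b); lra.
pose a := expR (t * (e * l%:R)).
have := @markov_prod _ _ _ _ _ X indep _ (@grid_cell n) (fun=> n.+1%:R^-1)
  (@measurable_grid_cell n) (fun i k => grid_cell_prob k (unif i))
  I id (fun _ k => expR (t * y k)) a 1 J s0 A B.
rewrite map_id; move/(_ (fun _ _ => expR_ge0 _) (expR_gt0 _) ler01 us mA mB).
move=> h; apply: le_trans (h _) _.
  move=> w /hB[rw X01 le]; split => //; rewrite mul1r -expR_sum ler_expR -mulr_sumr.
  rewrite ler_pM2l //; apply: le_trans le _; apply: ler_sum => i _.
  exact: y_dom.
rewrite lee_fin -mulrA ler_wpM2l ?rect_prob_ge0 // mul1r /a.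
rewrite ler_pdivrMr ?expR_gt0 // -exprMn -expRD -expRM_natl -expRD.
apply: (@le_trans _ _ (\prod_(j <- J) expR (t ^+ 2))).
  apply: ler_prod => j _; rewrite sumr_ge0 /=; last first.
    by move=> k _; rewrite mulr_ge0 ?expR_ge0 ?invr_ge0.
  by apply: grid_moment => //; [lra|rewrite /t; lra].
rewrite -expR_sum ler_expR big_const_seq count_predT iter_addr_0.
apply: (@le_trans _ _ (t ^+ 2 * l%:R)).
  by rewrite -[leLHS]mulr_natr ler_wpM2l ?sqr_ge0 // ler_nat.
by rewrite le_eqVlt; apply/orP; left; apply/eqP; field.
Qed.

End Chernoff.
End UniformLevels.

Section NullSets.
Context d (T : measurableType d) (R : realType) (P : probability T R).

Lemma measure_null (B : set T) :
  (forall th : R, 0 < th -> (P B <= th%:E)%E) -> P B = 0%E.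
Proof.
move=> h; apply/eqP; rewrite eq_le measure_ge0 andbT.
by apply/lee_addgt0Pr => e e0; rewrite add0e; apply: h.
Qed.

Lemma measurable_ge_set (f : T -> R) c : measurable_fun [set: T] f ->
  measurable [set t | c <= f t].
Proof.
move=> mf; rewrite (_ : [set t | _] = setT `&` f @^-1` `[c, +oo[).
  exact: mf.
by rewrite setTI; apply/seteqP; split => t /=; rewrite in_itv /= andbT.
Qed.

Lemma measurable_gt_set (f : T -> R) c : measurable_fun [set: T] f ->
  measurable [set t | c < f t].
Proof.
move=> mf; rewrite (_ : [set t | _] = setT `&` f @^-1` `]c, +oo[).
  exact: mf.
by rewrite setTI; apply/seteqP; split => t /=; rewrite in_itv /= andbT.
Qed.

Lemma measurable_lt_set (f : T -> R) c : measurable_fun [set: T] f ->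
  measurable [set t | f t < c].
Proof.
move=> mf; rewrite (_ : [set t | _] = ~` [set t | c <= f t]).
  exact/measurableC/measurable_ge_set.
by apply/seteqP; split => t /=; rewrite ltNge => /negP.
Qed.

Lemma measurable_le_set (f : T -> R) c : measurable_fun [set: T] f ->
  measurable [set t | f t <= c].
Proof.
move=> mf; rewrite (_ : [set t | _] = ~` [set t | c < f t]).
  exact/measurableC/measurable_gt_set.
by apply/seteqP; split => t /=; rewrite leNgt => /negP.
Qed.

Lemma measurable_forall (U : Type) (F : U -> set T) : countable [set: U] ->
  (forall i, measurable (F i)) -> measurable [set t | forall i, F i t].
Proof.
move=> cU mF; rewrite (_ : [set t | _] = ~` \bigcup_i ~` F i).
  apply: measurableC; apply: countable_bigcupT_measurable => // i.
  exact: measurableC.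
rewrite setC_bigcup; apply/seteqP; split => t /=.
  by move=> h i _; rewrite setCK.
by move=> h i; have := h i I; rewrite setCK.
Qed.

Lemma negligible_countable (U : Type) (F : U -> set T) : countable [set: U] ->
  (forall i, P.-negligible (F i)) -> P.-negligible (\bigcup_i F i).
Proof.
move=> /countable_injP[f fi] nF.
pose G n := [set t | exists2 i, f i = n & F i t].
apply: (@negligibleS _ _ _ _ (\bigcup_n G n)).
  by move=> t [i _ Fi]; exists (f i) => //; exists i.
apply: negligible_bigcup => n.
have [[i fin]|no] := pselect (exists i, f i = n).
  apply: negligibleS (nF i) => t [j fj Fj].
  by rewrite (fi i j) ?inE // fin fj.
apply: negligibleS (negligible_set0 P) => t [j fj _].
by apply: no; exists j.
Qed.

End NullSets.

(** * Measurability of [kappa] *)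

Section Measurability.
Context d (T : measurableType d) (R : realType) (V : choiceType) (E : rel V).

Lemma measurable_apply_moves (Y : V -> T -> R) ms v :
  (forall u, measurable_fun [set: T] (Y u)) ->
  measurable_fun [set: T] (fun t => apply_moves (Y^~ t) ms v).
Proof.
elim: ms Y => [|m ms IH] Y mY; first exact: mY.
apply: (IH (fun u t => apply_move (Y^~ t) m u)) => u.
case: m => x y mu /=; case: (u == x); last case: (u == y) => //.
  by apply: measurable_funD => //; apply: measurable_funM => //; apply: measurable_funB.
by apply: measurable_funD => //; apply: measurable_funM => //; apply: measurable_funB.
Qed.

Lemma kappa_ge0 (eta : V -> R) v : 0 <= kappa E eta v.
Proof.
rewrite /kappa; have [h|h] := pselect (has_sup (achievable E eta v)); last first.
  by rewrite sup_out.
have [[x Ax] _] := h; case: (Ax) => x0 _; apply: le_trans x0 _.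
exact: ub_le_sup h.2 _ Ax.
Qed.

(** Expresses the event through rational move sequences only. The second conjunct records
    boundedness: [sup] of an unbounded set is 0 by convention, and the levels are not assumed to lie
    in [[0, 1]]. *)
Lemma lt_kappaP (eta : V -> R) v r : 0 <= r ->
  r < kappa E eta v <->
  (exists s, all (valid_move E) (map (@rational_move R V) s) /\
     r < apply_moves eta (map (@rational_move R V) s) v) /\
  (exists n : nat, forall s, all (valid_move E) (map (@rational_move R V) s) ->
     apply_moves eta (map (@rational_move R V) s) v <= n%:R).
Proof.
move=> r0; split.
  have [h|h] := pselect (has_sup (achievable E eta v)); last first.
    by rewrite /kappa sup_out // ltNge r0.
  move=> rk; have [y [y0 [ms vms <-]] ry] := sup_gt h.1 rk.
  split.
    have [s' vs' hs'] := rational_moves_dense eta vms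
      (ltac:(rewrite divr_gt0 ?subr_gt0 //; exact: ry) : 0 < (apply_moves eta ms v - r) / 2).
    by exists s'; split => //; have := hs' v; lra.
  have [M Mub] := h.2; exists (Num.truncn M).+1 => s vs.
  apply: (@le_trans _ _ M); last by rewrite ltW // truncnS_gt.
  case: (lerP 0 (apply_moves eta (map (@rational_move R V) s) v)) => sgn.
    by apply: Mub; split => //; exists (map (@rational_move R V) s).
  apply: (le_trans (ltW sgn)); have [[x [x0 hx]] _] := h.
  exact: le_trans x0 (Mub x (conj x0 hx)).
move=> [[s [vs rs]] [n hn]].
have hub : has_ubound (achievable E eta v).
  exists (n%:R + 1) => _ [_ [ms vms <-]].
  have [s' vs' hs'] := rational_moves_dense eta vms (ltr01 : 0 < 1 :> R).
  by have := hs' v; have := hn s' vs'; lra.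
apply: (lt_le_trans rs); apply: ub_le_sup => //.
split; first exact: ltW (le_lt_trans r0 rs).
by exists (map (@rational_move R V) s).
Qed.

Lemma countable_move_seq : countable [set: V] -> countable [set: seq (V * V * rat)].
Proof.
move=> /countable_injP[f fi]; apply/countable_injP.
pose h (x : V * V * rat) : nat * nat * rat := (f x.1.1, f x.1.2, x.2).
have hi : injective h.
  move=> [[a b] c] [[a' b'] c'] [ea eb ->].
  have fi' : injective f by move=> x y; apply: fi; rewrite in_setT.
  by rewrite (fi' _ _ ea) (fi' _ _ eb).
exists (fun s => choice.pickle (map h s)) => s s' _ _ e.
exact: inj_map hi _ _ (pcan_inj choice.pickleK e).
Qed.

Lemma measurable_kappa (Y : V -> T -> R) v : countable [set: V] ->
  (forall u, measurable_fun [set: T] (Y u)) ->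
  measurable_fun [set: T] (fun t => kappa E (Y^~ t) v).
Proof.
move=> /countable_move_seq cV mY.
apply: (measurability _ (RGenOInfty.measurableE R)) => _ [_ [r ->] <-].
rewrite setTI; have [r0|r0] := leP 0 r; last first.
  rewrite (_ : _ @^-1` _ = setT); first exact: measurableT.
  apply/seteqP; split => t //= _; rewrite in_itv /= andbT.
  by apply: lt_le_trans r0 _; exact: kappa_ge0.
pose M s := map (@rational_move R V) s.
pose F s := [set t | all (valid_move E) (M s) /\ r < apply_moves (Y^~ t) (M s) v].
pose G (n : nat) s := [set t | all (valid_move E) (M s) ->
  apply_moves (Y^~ t) (M s) v <= n%:R].
have mM s := measurable_apply_moves (M s) v mY.
have mF s : measurable (F s).
  rewrite /F; have [vs|nvs] := boolP (all (valid_move E) (M s)); last first.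
    by rewrite (_ : [set t | _] = set0) //; apply/seteqP; split => t //= -[].
  rewrite (_ : [set t | _] = [set t | r < apply_moves (Y^~ t) (M s) v]).
    exact: measurable_gt_set.
  by apply/seteqP; split => t /=; [case|].
have mG n s : measurable (G n s).
  rewrite /G; have [vs|nvs] := boolP (all (valid_move E) (M s)); last first.
    by rewrite (_ : [set t | _] = setT) //; apply/seteqP; split.
  rewrite (_ : [set t | _] = [set t | apply_moves (Y^~ t) (M s) v <= n%:R]).
    exact: measurable_le_set.
  by apply/seteqP; split => t /=; [apply|].
rewrite (_ : _ @^-1` _ = (\bigcup_s F s) `&` (\bigcup_n [set t | forall s, G n s t])).
  apply: measurableI; first exact: countable_bigcupT_measurable.
  by apply: bigcupT_measurable => n; apply: measurable_forall.
apply/seteqP; split => t /=; rewrite in_itv /= andbT.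
  move=> /(lt_kappaP _ _ r0)[[s hs] [n hn]].
  by split; [exists s|exists n].
move=> [[s _ hs] [n _ hn]]; apply/(lt_kappaP _ _ r0).
by split; [exists s|exists n].
Qed.

End Measurability.

Section Levels.
Context d (T : measurableType d) (R : realType) (P : probability T R).
Variables (V : choiceType) (X : V -> {RV P >-> R}).
Hypothesis unif : forall u, uniform01 (X u).
Hypothesis countV : countable [set: V].

(** The strict upper bound serves [kappa < 1] on the line: finitely many levels then stay below 1 by
    a positive gap. *)
Definition in_unit : set T := [set t | forall u, 0 <= X u t < 1].

Let in_unitE : in_unit = [set t | forall u, (X u @^-1` `[0, 1[) t].
Proof. by apply/seteqP; split => t h u; have := h u; rewrite /= in_itv. Qed.

Lemma measurable_in_unit : measurable in_unit.
Proof.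
by rewrite in_unitE; apply: measurable_forall => // u; apply: measurable_preim.
Qed.

Lemma negligible_not_in_unit : P.-negligible (~` in_unit).
Proof.
apply: (@negligibleS _ _ _ _ (\bigcup_u (X u @^-1` ~` `[0, 1[))).
  move=> t /=; rewrite in_unitE => /existsNP[u hu]; exists u => //.
apply: negligible_countable => // u.
have m01 : measurable (~` (`[0, 1[ : set R)) by exact: measurableC.
exists (X u @^-1` ~` `[0, 1[); split => //; first exact: measurable_preim.
apply/eqP; rewrite eq_le measure_ge0 andbT.
have := @uniform01_le _ _ _ P (X u) _ 1 1 (unif u) m01 (lexx _).
rewrite subrr; apply => x [/= nx]; rewrite !in_itv /= in nx *.
move=> /andP[x0 x1]; apply/andP; split => //; rewrite leNgt.
by apply/negP => x1'; apply: nx; rewrite x0.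
Qed.

Lemma in_unit_le t : in_unit t -> forall u, 0 <= X u t <= 1.
Proof. by move=> h u; have /andP[-> /ltW] := h u. Qed.

End Levels.

(** * Graphs other than the line *)

Section Branching.
Context d (T : measurableType d) (R : realType) (P : probability T R).
Variables (V : choiceType) (E : rel V) (X : V -> {RV P >-> R}) (v : V).
Hypothesis indep : mutually_independent X.
Hypothesis unif : forall u, uniform01 (X u).
Hypothesis countV : countable [set: V].

Let k t := kappa E (fun u => X u t) v.

Lemma measurable_kappaX : measurable_fun [set: T] k.
Proof. by apply: measurable_kappa. Qed.

Hypothesis stations : exists C : nat, forall N,
  exists L q (st : seq (nat * V)),
  [/\ q 0%N = v, geodesic E q L &
   [/\ size st = N, sorted ltn (map fst st), uniq (map snd st),
     forall i s0, (i < N)%N -> ((nth s0 st i).1 < i.+1 * C)%N &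
     {in st, forall s, [/\ (s.1 <= L)%N, E (q s.1) s.2 &
       forall i, (i <= L)%N -> s.2 <> q i]}]].

(** On this event [missing] exceeds [th] for every family of stations. Markov's inequality bounds
    its probability by the mean of [missing] over [th], and this mean tends to 0 with the number of
    stations. *)
Lemma kappa_lt_null (g th : R) : 0 < g < 1 -> 0 < th ->
  P (in_unit X `&` [set t | k t < g * (1 - th)]) = 0%E.
Proof.
move=> /andP[g0 g1] th0; have [C hC] := stations.
set B := _ `&` _.
have mB : measurable B.
  apply: measurableI; first exact: measurable_in_unit.
  exact: measurable_lt_set measurable_kappaX.
(* Station [i] has position [j < i.+1 * C], so its mean factor [1 - (1 - g) / (2 (j + 1))] is at
   most [1 - c / i.+1]. Using [C.+1] avoids a zero denominator. *)
pose c := (1 - g) / (2 * C.+1%:R).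
have C0 : (0 : R) < C.+1%:R by rewrite ltr0n.
have c01 : 0 < c <= 1.
  rewrite divr_gt0 ?subr_gt0 ?mulr_gt0 //= ler_pdivrMr ?mulr_gt0 // mul1r.
  have : (1 : R) <= C.+1%:R by rewrite ler1n.
  lra.
have bound n : (P B <= ((1 + c * \sum_(i < n) (i.+1%:R)^-1)^-1 / th)%:E)%E.
  have [L [q [st [q0 gq [sz srt unq near hst]]]]] := hC n.
  pose p (b : bool) : R := if b then 1 - g else g.
  pose w (s : nat * V) (b : bool) : R := if b then 1 - (2 * s.1.+1%:R)^-1 else 1.
  pose cell (x : R) : bool := g <= x.
  have mcell b : measurable (cell @^-1` [set b]).
    rewrite /cell; apply: is_interval_measurable => x y /= xb yb z /andP[xz zy].
    case: b xb yb => [gx _|_ gy]; first exact: le_trans xz.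
    by apply: contraFF gy => gz; exact: le_trans zy.
  have pcell i b : (P (X i @^-1` (cell @^-1` [set b])) <= (p b)%:E)%E.
    case: b; rewrite /p; first last.
      rewrite -[g in leRHS]subr0; apply: uniform01_le => //; first exact: ltW.
      by move=> x [/= /negbT]; rewrite /cell -ltNge !in_itv /= => /ltW -> /andP[-> _].
    apply: uniform01_le => //; first exact: ltW.
    by move=> x [/=]; rewrite /cell => gx; rewrite !in_itv /= gx => /andP[_ ->].
  have w0 s b : 0 <= w s b.
    case: b; rewrite /w // subr_ge0 invf_le1 ?mulr_gt0 ?ltr0n //.
    by rewrite -natrM ler1n muln_gt0.
  have us : uniq (map snd st ++ [::]) by rewrite cats0.
  have h := @markov_prod _ _ _ _ _ X indep _ _ p mcell pcell _ snd w th 1 st [::]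
    (fun=> setT) B w0 th0 ler01 us (fun=> measurableT) mB.
  apply: le_trans (h _) _.
    move=> t [ut kt]; split; first by move=> i.
    rewrite mul1r ltW //.
    have X01 := in_unit_le ut.
    have q_inj i j := @geodesic_inj _ _ q L i j gq.
    have := @kappa_ge_stations R V E q L (fun u => X u t) g gq.1 q_inj
      (fun u => proj1 (andP (X01 u))) st (fun u => proj2 (andP (X01 u))) srt unq (ltW g0) hst.
    rewrite q0 => /le_lt_trans /(_ kt); rewrite ltr_pM2l // ltrD2l ltrN2.
    by rewrite /missing.
  rewrite lee_fin /rect_prob big_nil !mul1r ler_wpM2r ?invr_ge0 ?(ltW th0) //.
  apply: le_trans (prod_le_harmonic n c01).
  have [st0|n0] := posnP n.
    by rewrite (size0nil (etrans sz st0)) st0 big_nil big_ord0.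
  have s0 : nat * V by exact: (0%N, v).
  rewrite (big_nth s0) sz big_mkord; apply: ler_prod => i _.
  rewrite big_bool /p /w mulr1; set s := nth s0 st i.
  have lt := near i s0 (ltn_ord i); rewrite -/s in lt.
  have x0 : 0 < (2 * s.1.+1%:R)^-1 :> R by rewrite invr_gt0 mulr_gt0 ?ltr0n.
  have x1 : (2 * s.1.+1%:R)^-1 <= 1 :> R.
    by rewrite invf_le1 ?mulr_gt0 ?ltr0n // -natrM ler1n muln_gt0.
  apply/andP; split.
    by rewrite addr_ge0 ?mulr_ge0 ?subr_ge0 ?(ltW g1) ?(ltW g0).
  have : c / i.+1%:R <= (1 - g) * (2 * s.1.+1%:R)^-1.
    rewrite /c -mulrA ler_wpM2l ?subr_ge0 ?(ltW g1) //.
    rewrite -invfM lef_pV2 ?posrE ?mulr_gt0 ?ltr0n // -mulrA ler_wpM2l //.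
    by rewrite -natrM ler_nat; apply: leq_trans lt _; rewrite mulnC leq_mul2r leqnSn orbT.
  move: (2 * _)^-1 (c / _) => y z le.
  by change ((1 - g) * (1 - y) + g <= 1 - z); nra.
apply: measure_null => e e0.
have [n hn] := harmonic_unbounded ((e * th * c)^-1).
apply: le_trans (bound n) _; rewrite lee_fin ler_pdivrMr //.
have /andP[c0 _] := c01.
have et : 0 < e * th by rewrite mulr_gt0.
rewrite -[leRHS]invrK lef_pV2 ?posrE ?invr_gt0 //; last first.
  by rewrite ltr_wpDr // mulr_ge0 ?(ltW c0) // sumr_ge0 // => i _; rewrite invr_ge0.
have : c * (e * th * c)^-1 <= c * \sum_(i < n) i.+1%:R^-1 by rewrite ler_pM2l.
have -> : c * (e * th * c)^-1 = (e * th)^-1 by rewrite invfM mulrCA mulfV ?mulr1 // gt_eqF.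
lra.
Qed.

Lemma branching_kappa1 : {ae P, forall t, k t = 1}.
Proof.
apply: (@negligibleS _ _ _ _ (~` in_unit X `|`
    \bigcup_n (in_unit X `&` [set t | k t < (1 - n.+2%:R^-1) * (1 - n.+2%:R^-1)]))).
  move=> t /= kt; have [ut|nu] := pselect (in_unit X t); last by left.
  right; have k1 : k t < 1.
    rewrite lt_neqAle; apply/andP; split; first exact/eqP.
    by apply: kappa_le1; exact: in_unit_le.
  pose x := 1 - k t; have x0 : 0 < x by rewrite subr_gt0.
  (* With [y = 1 / (n + 2) < x / 2], the product [(1 - y) * (1 - y)] exceeds [1 - x = k t]. *)
  exists (Num.truncn (2 / x)) => //; split => //=.
  set y := _^-1; have y0 : 0 < y by rewrite invr_gt0 ltr0n.
  have yx : 2 * y < x.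
    rewrite /y ltr_pdivrMr ?ltr0n // [x * _]mulrC -ltr_pdivrMr //.
    by apply: lt_trans (truncnS_gt _) _; rewrite ltr_nat.
  by rewrite /x in yx; nra.
apply: negligibleU; first exact: negligible_not_in_unit.
apply: negligible_bigcup => n.
have n0 : (0 : R) < n.+2%:R^-1 by rewrite invr_gt0 ltr0n.
have n1 : n.+2%:R^-1 < 1 :> R by rewrite invf_lt1 ?ltr0n // ltr1n.
have mB : measurable (in_unit X `&`
    [set t | k t < (1 - n.+2%:R^-1) * (1 - n.+2%:R^-1)]).
  apply: measurableI; first exact: measurable_in_unit.
  exact: measurable_lt_set measurable_kappaX.
apply/(negligibleP _ mB)/kappa_lt_null => //.
by rewrite subr_gt0 n1 ltrBlDr ltrDl.
Qed.

End Branching.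

(** * The line: random levels *)

Definition window (b : bool) (p : int) (k : nat) : seq int :=
  [seq if b then p + j%:Z else p - 1 - j%:Z | j <- iota 0 k].

Lemma window_uniq b p k : uniq (window b p k).
Proof.
rewrite map_inj_uniq ?iota_uniq // => i j; case: b; lia.
Qed.

Lemma size_window b p k : size (window b p k) = k.
Proof. by rewrite size_map size_iota. Qed.

Lemma window_bounded b p k u : u \in window b p k -> (`|u| <= `|p| + k)%N.
Proof. by move=> /mapP[j]; rewrite mem_iota; case: b => + ->; lia. Qed.

Definition far_part (n : nat) (s : seq int) := [seq u <- s | (n < `|u|)%N].

(** * Deterministic bounds on [kappa] from window averages *)

Section FlatWindows.
Variable R : realType.

(** The bad event: some window at [p] of length comparable to [|p|] has excess over the mean. Only
    vertices outside [[-n, n]] are counted, though against the full length, so that the event is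
    independent of the levels near 0. *)
Definition steep (eta : int -> R) (M n : nat) (e : R) :=
  exists b p k, (`|p| < k * M)%N /\
    e * k%:R <= \sum_(u <- far_part n (window b p k)) centered true (eta u).

(** Near levels are at most [be], and the excess of far levels over [be] is controlled by [al] times
    their deviation from 1/2; so window averages are at most [be + al * e], and [line_upper]
    applies. *)
Lemma kappa_not_steep (eta : int -> R) (M n : nat) (e al be : R) :
  (forall u, 0 <= eta u <= 1) -> (0 < M)%N -> ~ steep eta M n e ->
  0 <= al -> be + al * e <= 1 ->
  (forall u, (`|u| <= n)%N -> eta u <= be) ->
  (forall u, eta u - be <= al * (eta u - 2^-1)) ->
  kappa Zpath eta 0 <= be + al * e + 2 * (1 - (be + al * e)) / M%:R.
Proof.
move=> eta01 M0 flat al0 lam1 near far; apply: kappa_le => // ms vms.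
have win b p k : (`|p| < k * M)%N ->
    \sum_(u <- window b p k) eta u <= (be + al * e) * k%:R.
  move=> pk; have : \sum_(u <- window b p k) (eta u - be) <= al * (e * k%:R).
    rewrite (bigID (fun u => (n < `|u|)%N)) /=.
    apply: (@le_trans _ _ (al * \sum_(u <- far_part n (window b p k)) centered true (eta u) + 0)).
      apply: lerD.
        by rewrite /far_part big_filter mulr_sumr; apply: ler_sum => u _; exact: far.
      by apply: sumr_le0 => u; rewrite -leqNgt => /near; rewrite subr_le0.
    rewrite addr0 ler_wpM2l // leNgt; apply/negP => lt; apply: flat.
    by exists b, p, k; split => //; exact: ltW.
  rewrite sumrB big_const_seq count_predT iter_addr_0 size_window -mulr_natr.
  by rewrite mulrDl -mulrA; lra.
apply: line_upper => // [u|p k pk]; first by case/andP: (eta01 u).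
have iotaE (f : nat -> R) : \sum_(j < k) f j = \sum_(j <- iota 0 k) f j.
  by rewrite -[k in iota 0 k]subn0 -/(index_iota 0 k) big_mkord.
split; first by have := win true p k pk; rewrite big_map -iotaE.
by have := win false p k pk; rewrite big_map -iotaE.
Qed.

Lemma finite_gap (eta : int -> R) n : (forall u, eta u < 1) ->
  exists2 dl : R, 0 < dl <= 2^-1 & forall u, (`|u| <= n)%N -> eta u <= 1 - dl.
Proof.
move=> lt1; elim: n => [|n [dl dl0 IH]].
  exists (Num.min (1 - eta 0) 2^-1).
    by rewrite lt_min subr_gt0 lt1 ge_min lexx orbT andbT invr_gt0 ltr0n.
  by move=> u; rewrite leqn0 absz_eq0 => /eqP ->; rewrite lerBrDl -lerBrDr ge_min lexx.
exists (Num.min dl (Num.min (1 - eta n.+1%:Z) (1 - eta (- n.+1%:Z)))).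
  case/andP: dl0 => dl0 dl1.
  by rewrite !lt_min dl0 !subr_gt0 !lt1 /= ge_min dl1.
move=> u un; rewrite lerBrDl -lerBrDr !ge_min.
have [un'|un'] := leqP `|u|%N n.
  by apply/orP; left; have := IH u un'; lra.
have [->|->] : u = n.+1%:Z \/ u = - n.+1%:Z by lia.
  by rewrite lexx orbT.
by rewrite lexx !orbT.
Qed.

Lemma kappa_not_steep_lt1 (eta : int -> R) n : (forall u, 0 <= eta u < 1) ->
  ~ steep eta 4 n 8^-1 -> kappa Zpath eta 0 < 1.
Proof.
move=> eta01 flat.
have [dl /andP[dl0 dl1] gap] := @finite_gap eta n (fun u => proj2 (andP (eta01 u))).
have e01 u : 0 <= eta u <= 1 by have /andP[-> /ltW] := eta01 u.
(* These values make the affine bound on far levels an equality at level 1; the result is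
   [1 - 3 dl / 8]. *)
have := @kappa_not_steep eta 4 n 8^-1 (2 * dl) (1 - dl) e01 isT flat.
move=> h; apply: le_lt_trans (h _ _ gap _) _; [lra|lra| |lra].
by move=> u; have /andP[_ u1] := e01 u; nra.
Qed.

Lemma kappa_not_steep_half (eta : int -> R) M n e : (forall u, 0 <= eta u <= 1) ->
  (forall u, (`|u| <= n)%N -> eta u <= 2^-1) -> 0 < e -> e <= 2^-1 ->
  (0 < M)%N -> ~ steep eta M n e ->
  kappa Zpath eta 0 <= 2^-1 + e + M%:R^-1.
Proof.
move=> e01 near e0 e1 M0 flat.
have := @kappa_not_steep eta M n e 1 2^-1 e01 M0 flat ler01.
rewrite !mul1r => h; apply: le_trans (h _ near _) _; [lra|by move=> u; lra|].
have Mi : 0 <= M%:R^-1 :> R by rewrite invr_ge0.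
by rewrite lerD2l; nra.
Qed.

End FlatWindows.

(** * Random levels on the line *)

Section LineLevels.
Context d (T : measurableType d) (R : realType) (P : probability T R).
Variable X : int -> {RV P >-> R}.
Hypothesis indep : mutually_independent X.
Hypothesis unif : forall u, uniform01 (X u).

Lemma measurable_window_sum (s : seq int) b :
  measurable_fun [set: T] (fun t => \sum_(u <- s) centered b (X u t)).
Proof.
apply: measurable_sum => u.
by case: b; rewrite /centered; apply: measurable_funB.
Qed.

(** A union bound over all windows. The far parts avoid the coordinates in [s0], so the probability
    of the rectangle stays as a factor and [n] does not depend on the rectangle. *)
Lemma steep_small (M : nat) (e th : R) : 0 < e <= 1 -> (0 < M)%N -> 0 < th ->
  exists n : nat, forall (s0 : seq int) (A : int -> set R) (B : set T),
    uniq s0 -> {in s0, forall u, (`|u| <= n)%N} ->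
    (forall u, measurable (A u)) -> measurable B ->
    (forall t, B t -> [/\ rect X s0 A t, in_unit X t &
       steep (fun u => X u t) M n e]) ->
    (P B <= (rect_prob X s0 A * th)%:E)%E.
Proof.
move=> e01 M0 th0; have /andP[e0 _] := e01.
have [r /andP[r0 r1] cher] := uniform_sum_tail indep unif e01.
have M0' : (0 : R) < M%:R by rewrite ltr0n.
(* [D * r ^+ k0] bounds the sum over [k > k0] of [4 k M r ^+ k r ^+ k]: one [1 / (1 - r)] comes from
   [k * r ^+ k], the other from the geometric tail. *)
pose D := 4 * M%:R / (1 - r) / (1 - r).
have r1' : 0 < 1 - r by rewrite subr_gt0.
have D0 : 0 < D by rewrite !divr_gt0 // mulr_gt0.
have [k0 k0P] := @exprn_small R r (th / D) (ltW r0) r1 (divr_gt0 th0 D0).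
(* A window of length [k <= k0] with [|p| < k * M] stays within [k * M.+1] of 0, so its far part is
   empty. *)
exists (k0 * M.+1)%N => s0 A B us hs mA mB hB; set n := (k0 * M.+1)%N in hs hB.
set Q := rect_prob X s0 A; have Q0 : 0 <= Q := rect_prob_ge0 X s0 A.
(* All [p] with [|p| < k * M], in both directions: [4 k M] windows at most. *)
pose S k : seq (int * bool) :=
  [seq (i%:Z - (k * M)%:Z, b) | i <- iota 0 (2 * k * M), b <- [:: true; false]].
have sizeS k : size (S k) = (4 * k * M)%N.
  by rewrite size_allpairs size_iota /=; clear; lia.
pose G k (x : int * bool) := B `&`
  [set t | e * k%:R <= \sum_(u <- far_part n (window x.2 x.1 k)) centered true (X u t)].
have mG k x : measurable (G k x).
  by apply: measurableI => //; apply: measurable_ge_set; exact: measurable_window_sum.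
pose F k := \big[setU/set0]_(x <- S k) G k x.
pose g k : R := if (k0 < k)%N then r ^+ k else 0.
have PG k x : x \in S k -> (P (G k x) <= (Q * (r ^+ k * g k))%:E)%E.
  move=> /allpairsP[[i b] [/=]]; rewrite mem_iota => ik _ -> {x}.
  rewrite /G /=; set s := far_part n _; set B' := _ `&` _.
  rewrite /g; have [kk|kk] := ltnP k0 k; last first.
    rewrite mulr0 mulr0 (_ : B' = set0) ?measure0 //.
    apply/seteqP; split => // t [_ /=].
    rewrite (_ : s = [::]) ?big_nil.
      by rewrite leNgt mulr_gt0 // ltr0n; case: (k) ik; rewrite ?muln0.
    apply/eqP; rewrite -size_eq0 size_filter -leqn0 leqNgt -has_count.
    apply/hasPn => u /window_bounded ub; rewrite -leqNgt; apply: leq_trans ub _.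
    have : (k * M.+1 <= n)%N by rewrite leq_mul2r kk orbT.
    by rewrite mulnS; clear -ik; lia.
  apply: (cher true s) => //.
  - rewrite cat_uniq us andbT filter_uniq ?window_uniq //=.
    by apply/hasPn => u /hs un; rewrite mem_filter ltnNge un.
  - by rewrite size_filter (leq_trans (count_size _ _)) ?size_window.
  - exact: (mG k (i%:Z - (k * M)%:Z, b)).
  - by move=> t [/hB[rt ut _] le]; split => //; exact: in_unit_le.
have PF k : (P (F k) <= (Q * (4 * M%:R / (1 - r) * g k))%:E)%E.
  apply: (@le_trans _ _ (\sum_(x <- S k) P (G k x))%E).
    apply: measure_le_sum => //; first exact: bigsetU_measurable.
    by move=> t; rewrite /F -bigcup_seq => -[x xS Gx]; exists x.
  rewrite big_seq; apply: (@le_trans _ _ (\sum_(x <- S k | x \in S k) (Q * (r ^+ k * g k))%:E)%E).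
    by apply: lee_sum => x xS; exact: PG.
  rewrite -big_seq sumEFin lee_fin big_const_seq count_predT iter_addr_0 sizeS.
  have g0 : 0 <= g k by rewrite /g; case: ifP => // _; rewrite exprn_ge0 // ltW.
  have le1 : k%:R * r ^+ k <= (1 - r)^-1.
    rewrite -[leRHS]mul1r ler_pdivlMr //; apply: le_trans (natmul_expr_le k (ltW r0) r1) _.
    by rewrite gerBl exprn_ge0 // ltW.
  have -> : Q * (r ^+ k * g k) *+ (4 * k * M) = Q * (4 * M%:R * g k) * (k%:R * r ^+ k).
    by rewrite -mulr_natr !natrM; ring.
  have -> : Q * (4 * M%:R / (1 - r) * g k) = Q * (4 * M%:R * g k) * (1 - r)^-1 by ring.
  by rewrite ler_wpM2l // !mulr_ge0.
apply: (measure_le_series (F := F) _ mB _ PF).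
- by move=> k; apply: bigsetU_measurable.
- move=> t Bt; have [_ _ [b [p [k [pk le]]]]] := hB t Bt.
  exists k => //; rewrite /F -bigcup_seq; exists (p, b) => //=.
  apply/allpairsP; exists (`|(p + (k * M)%:Z)%R|%N, b); split => /=.
  + by rewrite mem_iota; clear -pk; lia.
  + by case: (b); rewrite !inE.
  + by congr (_, _); clear -pk; lia.
- move=> m; rewrite -mulr_sumr ler_wpM2l // -mulr_sumr.
  have tail : \sum_(k < m) g k <= r ^+ k0 / (1 - r).
    by rewrite ler_pdivlMr //; apply: geometric_tail => //; exact: ltW.
  apply: (@le_trans _ _ (D * r ^+ k0)).
    have -> : D * r ^+ k0 = 4 * M%:R / (1 - r) * (r ^+ k0 / (1 - r)).
      by rewrite /D; ring.
    by rewrite ler_wpM2l // divr_ge0 ?mulr_ge0 // ltW.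
  by have := ltW k0P; rewrite ler_pdivlMr // mulrC.
Qed.

Let k t := kappa Zpath (fun u => X u t) 0.

Let countZ : countable [set: int].
Proof. exact: countableP. Qed.

Let mk : measurable_fun [set: T] k.
Proof. exact: measurable_kappaX. Qed.

(** The event does not depend on [n], yet up to a null set it forces steepness for every [n], whose
    probability can be made arbitrarily small. *)
Lemma line_kappa_lt1 : P.-negligible [set t | 1 <= k t].
Proof.
apply: (@negligibleS _ _ _ _ (~` in_unit X `|` (in_unit X `&` [set t | 1 <= k t]))).
  by move=> t /= kt; have [ut|nu] := pselect (in_unit X t); [right|left].
apply: negligibleU; first exact: negligible_not_in_unit.
set B := _ `&` _.
have mB : measurable B.
  by apply: measurableI; [exact: measurable_in_unit|exact: measurable_ge_set].
apply/(negligibleP _ mB)/measure_null => th th0.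
have e01 : 0 < (8^-1 : R) <= 1 by lra.
have [n hn] := @steep_small 4 8^-1 th e01 isT th0.
have := hn [::] (fun=> setT) B isT (fun _ => ltac:(by [])) (fun=> measurableT) mB.
rewrite /rect_prob big_nil mul1r; apply => t [ut kt]; split => //.
apply: contrapT => flat; move: kt => /=; rewrite leNgt => /negP; apply.
exact: kappa_not_steep_lt1 flat.
Qed.

Lemma some_level_gt_half : P.-negligible [set t | forall m : nat, X m.+1%:Z t <= 2^-1].
Proof.
set B := [set t | _].
pose A (u : int) : set R := `]-oo, 2^-1]%classic.
have mA u : measurable (A u) by exact: measurable_itv.
have mB : measurable B.
  apply: (measurable_forall (F := fun m t => X m.+1%:Z t <= 2^-1)) => // m.
  exact: measurable_le_set.
apply/(negligibleP _ mB)/measure_null => th th0.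
have [n hn] := @exprn_small R 2^-1 th (ltac:(lra)) (ltac:(lra)) th0.
pose s := [seq i.+1%:Z | i <- iota 0 n].
have us : uniq s by rewrite map_inj_uniq ?iota_uniq // => i j [].
apply: (@le_trans _ _ (P (rect X s A))).
  apply: le_measure; rewrite ?inE //; first exact: measurable_rect.
  by move=> t Bt u /= /mapP[i _ ->]; rewrite /A /= in_itv /=; exact: Bt.
rewrite rectE // lee_fin; apply: le_trans (ltW hn).
rewrite /rect_prob; apply: (@le_trans _ _ (\prod_(u <- s) 2^-1)).
  apply: ler_prod => u _; rewrite fine_ge0 //= -lee_fin fineK; last first.
    by apply: fin_num_measure; apply: measurable_preim.
  rewrite -[2^-1 in leRHS]subr0; apply: uniform01_le => //.
  by move=> x [/=]; rewrite /A /= !in_itv /= => xh /andP[-> _].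
by rewrite big_const_seq count_predT iter_mulr_1 size_map size_iota.
Qed.

(** One window with average above [1/2 - e] suffices for the lower bound, so it is enough that all
    of them failing together is null. *)
Lemma left_average (m : nat) (e : R) : 0 < e <= 1 ->
  P.-negligible (in_unit X `&` [set t | forall n : nat,
    e * (m + n)%:R <= \sum_(u <- window false m%:Z (m + n)) centered false (X u t)]).
Proof.
move=> e01; set B := _ `&` _.
have mB : measurable B.
  apply: measurableI; first exact: measurable_in_unit.
  apply: (measurable_forall (F := fun n t =>
    e * (m + n)%:R <= \sum_(u <- window false m%:Z (m + n)) centered false (X u t))) => // n.
  by apply: measurable_ge_set; exact: measurable_window_sum.
apply/(negligibleP _ mB)/measure_null => th th0.
have [r /andP[r0 r1] cher] := uniform_sum_tail indep unif e01.
have [n hn] := exprn_small (ltW r0) r1 th0.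
have us : uniq (window false m%:Z (m + n) ++ [::]) by rewrite cats0 window_uniq.
have := cher false _ [::] (fun=> setT) (m + n)%N B us
  (ltac:(by rewrite size_window)) (fun=> measurableT) mB.
rewrite /rect_prob big_nil mul1r => h; apply: le_trans (h _) _.
  by move=> t [ut ht]; split; [move=> u|exact: in_unit_le|exact: ht].
rewrite lee_fin; apply: le_trans (ltW hn).
rewrite -exprD; apply: ler_wiXn2l; [exact: ltW|exact: ltW|lia].
Qed.

Lemma line_kappa_gt_half : P.-negligible [set t | k t <= 2^-1].
Proof.
apply: (@negligibleS _ _ _ _ (~` in_unit X `|`
  ([set t | forall m : nat, X m.+1%:Z t <= 2^-1] `|`
   \bigcup_m \bigcup_l (in_unit X `&` [set t | forall n : nat,
    l.+1%:R^-1 * (m + n)%:R <= \sum_(u <- window false m%:Z (m + n)) centered false (X u t)])))).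
  move=> t /= kt; have [ut|nu] := pselect (in_unit X t); last by left.
  right; have [low|/existsNP[m /negP]] := pselect (forall m : nat, X m.+1%:Z t <= 2^-1).
    by left.
  rewrite -ltNge => hm; right; set a := X m.+1%:Z t in hm.
  have a0 : 0 < a - 2^-1 by rewrite subr_gt0.
  (* Chosen so that the loss [m.+1 * e] from an average just above [1/2 - e] is less than the gain
     [a - 1/2] at [m.+1]. *)
  pose l := Num.truncn (m.+1%:R / (a - 2^-1)).
  exists m.+1 => //; exists l => //; split => // n.
  set e := l.+1%:R^-1.
  have e0 : 0 < e by rewrite invr_gt0 ltr0n.
  have em : m.+1%:R * e < a - 2^-1.
    by rewrite /e ltr_pdivrMr ?ltr0n // mulrC -ltr_pdivrMr // truncnS_gt.
  rewrite leNgt; apply/negP => lt.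
  have low := @line_lower R (fun u => X u t) m.+1 n (in_unit_le ut) isT.
  set S := \sum_(j < m.+1 + n) _ in low.
  have L0 : (0 : R) < (m.+1 + n)%:R by rewrite ltr0n addSn.
  have SE : \sum_(u <- window false m.+1%:Z (m.+1 + n)) centered false (X u t) =
      (m.+1 + n)%:R / 2 - S.
    rewrite sumrB big_const_seq count_predT iter_addr_0 size_window mulr_natl.
    congr (_ - _); rewrite big_map /S.
    by rewrite -{1}[(m.+1 + n)%N]subn0 -/(index_iota 0 (m.+1 + n)) big_mkord.
  have avg : 2^-1 - e < S / (m.+1 + n)%:R.
    by rewrite ltr_pdivlMr // mulrBl; move: lt; rewrite SE; lra.
  suff : 2^-1 < k t by rewrite ltNge kt.
  apply: lt_le_trans low; rewrite ltr_pdivlMr ?ltr0n // -/a.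
  have : m.+1%:R * (2^-1 - e) < m.+1%:R * (S / (m.+1 + n)%:R) by rewrite ltr_pM2l ?ltr0n.
  rewrite -[m.+2%:R]natr1; move: em; move: (m.+1%:R : R) (S / _) => x y.
  by clearbody e => h1 h2; nra.
apply: negligibleU; first exact: negligible_not_in_unit.
apply: negligibleU; first exact: some_level_gt_half.
apply: negligible_bigcup => m; apply: negligible_bigcup => l.
by apply: left_average; rewrite invr_gt0 ltr0n invf_le1 ?ltr0n // ler1n.
Qed.

Lemma line_kappa_strict : P [set t | 2^-1 < k t < 1] = 1%E.
Proof.
set S := [set t | _].
have mS : measurable S.
  rewrite (_ : S = [set t | 2^-1 < k t] `&` [set t | k t < 1]).
    by apply: measurableI; [exact: measurable_gt_set|exact: measurable_lt_set].
  by apply/seteqP; split => t /=; [move=> /andP|move=> []; rewrite /S /= => -> ->].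
have : P (~` S) = 0%E.
  apply/(negligibleP _ (measurableC mS)).
  apply: (@negligibleS _ _ _ _ ([set t | k t <= 2^-1] `|` [set t | 1 <= k t])).
    move=> t /= /negP; rewrite negb_and -!leNgt => /orP[]; [by left|by right].
  by apply: negligibleU; [exact: line_kappa_gt_half|exact: line_kappa_lt1].
move=> S0; rewrite -[S]setCK probability_setC; last exact: measurableC.
by rewrite S0 sube0.
Qed.

Lemma measurable_near c (e : R) : measurable [set t | `|k t - c| < e].
Proof.
rewrite (_ : [set t | _] = [set t | c - e < k t] `&` [set t | k t < c + e]).
  by apply: measurableI; [exact: measurable_gt_set|exact: measurable_lt_set].
apply/seteqP; split => t /=; rewrite ltr_norml.
  by move=> /andP[? ?]; split; lra.
by move=> [? ?]; apply/andP; split; lra.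
Qed.

(** The event [A] is too likely to be covered by [B] and a null set alone. *)
Lemma support_intro (c e q q' : R) (A B N : set T) :
  measurable A -> measurable B -> P.-negligible N ->
  (q%:E <= P A)%E -> (P B <= q'%:E)%E -> q' < q ->
  A `<=` [set t | `|k t - c| < e] `|` B `|` N ->
  (0 < P [set t | (`|k t - c| < e)%R])%E.
Proof.
move=> mA mB [N' [mN' N0 NN']] qA Bq qq sub.
rewrite lt_neqAle measure_ge0 andbT eq_sym; apply/eqP => S0.
have mS := measurable_near c e; set S := [set t | _] in mS S0 sub.
have : (P A <= P (S `|` B `|` N'))%E.
  apply: le_measure; rewrite ?inE //; first by do 2 apply: measurableU => //.
  by move=> t /sub[[St|Bt]|/NN' Nt]; [left; left|left; right|right].
have h1 : (P (S `|` B `|` N') <= P (S `|` B) + P N')%E.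
  by apply: measureU2 => //; exact: measurableU.
have h2 : (P (S `|` B) <= P S + P B)%E by exact: measureU2.
rewrite N0 adde0 in h1; rewrite S0 add0e in h2.
move=> h; have := le_trans qA (le_trans h (le_trans h1 (le_trans h2 Bq))).
by rewrite lee_fin leNgt qq.
Qed.

(** With positive probability the level at 0 is already close to 1; it bounds [kappa] from below
    with no move, and almost surely [kappa < 1]. *)
Lemma line_support1 : support_of P k 1.
Proof.
move=> e e0; pose x := Num.min (e / 2) 2^-1.
have x0 : 0 < x by rewrite lt_min divr_gt0 // invr_gt0 ltr0n.
have x1 : x <= 2^-1 by rewrite ge_min lexx orbT.
have xe : x <= e / 2 by rewrite ge_min lexx.
apply: (@support_intro 1 e x 0 (X 0 @^-1` `[1 - x, 1]) set0
   (~` in_unit X `|` [set t | 1 <= k t])).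
- by apply: measurable_preim.
- exact: measurable0.
- by apply: negligibleU; [exact: negligible_not_in_unit|exact: line_kappa_lt1].
- rewrite -[x in leLHS](subKr 1); apply: uniform01_ge => //; lra.
- by rewrite measure0.
- exact: x0.
move=> t /=; rewrite in_itv /= => /andP[xX _].
have [ut|nu] := pselect (in_unit X t); last by right; left.
have [k1|k1] := leP 1 (k t); first by right; right.
left; left.
have : X 0 t <= k t.
  exact: (kappa_ge_reach 0 (in_unit_le ut) (reach_refl _ (fun=> lexx _))).
by rewrite ltr_norml => h; apply/andP; split; lra.
Qed.

(** On the positive-probability rectangle where all levels in [[-n, n]] are at most 1/2, steepness
    takes at most half of the mass. On the rest [kappa] is at most [1/2 + x + 1 / M < 1/2 + e], and
    almost surely above 1/2. *)
Lemma line_support_half : support_of P k 2^-1.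
Proof.
move=> e e0; pose x := Num.min (e / 4) 2^-1.
have x0 : 0 < x by rewrite lt_min divr_gt0 // invr_gt0 ltr0n.
have x1 : x <= 2^-1 by rewrite ge_min lexx orbT.
have xe : x <= e / 4 by rewrite ge_min lexx.
pose M := (Num.truncn (4 / e)).+1.
have MR : (0 : R) < M%:R by rewrite ltr0n.
have Me : M%:R^-1 < e / 4.
  by rewrite -[ltRHS]invrK invf_div ltf_pV2 ?posrE ?divr_gt0 // truncnS_gt.
have h01 : 0 < x <= 1 by rewrite x0; lra.
(* The bound 1/2 is relative to the probability of the rectangle, so [n] can be fixed before the
   rectangle is defined. *)
have [n hn] := @steep_small M x 2^-1 h01 isT (ltac:(lra)).
pose s := [seq i%:Z - n%:Z | i <- iota 0 (2 * n).+1].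
have us : uniq s by rewrite map_inj_uniq ?iota_uniq // => i j; clear; lia.
have sn : {in s, forall u, (`|u| <= n)%N}.
  by move=> u /mapP[i]; rewrite mem_iota => + ->; clear; lia.
have ns u : (`|u| <= n)%N -> u \in s.
  by move=> un; apply/mapP; exists `|(u + n%:Z)%R|%N; [rewrite mem_iota|]; clear -un; lia.
pose A (u : int) : set R := `]-oo, 2^-1]%classic.
have mA u : measurable (A u) by exact: measurable_itv.
pose Q := rect_prob X s A.
have Q0 : 0 < Q.
  apply: prodr_gt0 => u _; apply: (@lt_le_trans _ _ (2^-1 - 0)); first by lra.
  rewrite -lee_fin fineK; last by apply: fin_num_measure; apply: measurable_preim.
  apply: uniform01_ge => //; first by lra.
  by move=> y; rewrite /A /= !in_itv /= => /andP[].
pose B := rect X s A `&` (in_unit X `&` [set t | 2^-1 + e <= k t]).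
have mB : measurable B.
  apply: measurableI; first exact: measurable_rect.
  by apply: measurableI; [exact: measurable_in_unit|exact: measurable_ge_set].
apply: (@support_intro 2^-1 e Q (Q * 2^-1) (rect X s A) B
   (~` in_unit X `|` [set t | k t <= 2^-1])).
- exact: measurable_rect.
- exact: mB.
- by apply: negligibleU; [exact: negligible_not_in_unit|exact: line_kappa_gt_half].
- by rewrite rectE.
- apply: (hn s A B us sn mA mB) => t [rt [ut kt]]; split => //.
  apply: contrapT => flat; move: kt => /=; apply/negP; rewrite -ltNge.
  have := @kappa_not_steep_half R (fun u => X u t) M n x (in_unit_le ut) _ x0 x1 isT flat.
  move=> h; apply: le_lt_trans (h _) _; last by lra.
  by move=> u /ns us'; have := rt u us'; rewrite /A /= in_itv.
- lra.
move=> t rt.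
have [ut|nu] := pselect (in_unit X t); last by right; left.
have [k1|k1] := leP (k t) 2^-1; first by right; right.
left; have [k2|k2] := leP (2^-1 + e) (k t); first by right.
by left; rewrite /= ltr_norml; apply/andP; split; lra.
Qed.

End LineLevels.

Lemma mutually_independent_comp (R : realType) (d : measure_display)
    (T : measurableType d) (P : probability T R) (V W : choiceType)
    (X : V -> {RV P >-> R}) (h : W -> V) :
  bijective h -> mutually_independent X -> mutually_independent (X \o h).
Proof.
move=> [h' hK h'K] indep s A us mA.
have := indep (map h s) (A \o h'); rewrite map_inj_uniq; last exact: can_inj hK.
move=> /(_ us (fun i => mA _)); rewrite !bigcap_seq !big_map /=.
rewrite (eq_bigr (fun i => X (h i) @^-1` A i)) => [->|i _]; last by rewrite hK.
by apply: eq_bigr => i _; rewrite hK.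
Qed.

Theorem theorem3p1 (R : realType) (d : measure_display) (T : measurableType d)
    (P : probability T R) (V : choiceType) (E : rel V)
    (V_infinite : infinite_set [set: V])
    (E_simple : simple_graph E)
    (E_connected : connected_graph E)
    (E_quasi_transitive : quasi_transitive E)
    (E_bounded_degree : bounded_degree E)
    (eta0 : V -> {RV P >-> R})
    (eta0_independent : mutually_independent eta0)
    (eta0_uniform : forall u : V, uniform01 (eta0 u))
    (v : V) :
  let kappa_v : T -> R := fun t => kappa E (fun u => eta0 u t) v in
  measurable_fun [set: T] kappa_v /\
  (graph_isomorphic E Zpath ->
     P [set t | 2^-1 < kappa_v t < 1] = 1%E /\
     [set 2^-1; 1] `<=` support_of P kappa_v) /\
  (~ graph_isomorphic E Zpath ->
     {ae P, forall t, kappa_v t = 1}).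
Proof.
move=> kappa_v.
have countV : countable [set: V] by exact: countable_vertices.
split; first exact: measurable_kappaX.
split=> [[f [f' fK f'K] fE]|not_line].
  (* The isomorphism is translated so that [v] corresponds to 0. *)
  pose h i := f' (i + f v).
  have h_bij : bijective h.
    by exists (fun u => f u - f v) => [i|u]; rewrite /h ?f'K ?addrK // subrK fK.
  have hE a b : E (h a) (h b) = Zpath a b.
    by rewrite -fE !f'K /Zpath /= !(addrAC _ (f v)) !(inj_eq (addIr _)).
  pose X := eta0 \o h.
  have indepX : mutually_independent X by exact: mutually_independent_comp.
  have unifX i : uniform01 (X i) by exact: eta0_uniform.
  have kE : kappa_v = fun t => kappa Zpath (fun u => X u t) 0.
    apply/funext => t; rewrite /kappa_v.
    have -> : v = h 0 by rewrite /h add0r fK.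
    exact: kappa_iso.
  rewrite kE; split; first exact: line_kappa_strict.
  by move=> _ [->|->]; [exact: line_support_half|exact: line_support1].
apply: branching_kappa1 => //.
(* If no vertex had three neighbours, the graph would be the line. *)
apply: stations_exist => //; apply: contrapT => /forallNP nobranch.
by apply: not_line; exact: line_isomorphic.
Qed.
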